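(* Let $G$ be a topological group. For a (nondegenerately) based $G$-space $X$, the composite $G$-map $$\Sigma X\xrightarrow{\ \Sigma\eta_{\mathbb{M}}\ }\Sigma\mathbb{M}X\xrightarrow{\ \iota\ }B\mathbb{M}X$$ is a weak equivalence of $G$-spaces.
   Context: $\mathbb{M}X$ is the free topological monoid on $X$ with the basepoint as unit (the James construction), with $G$ acting diagonally on words, so that it is a $G$-monoid; $\eta_{\mathbb{M}}\colon X\to\mathbb{M}X$ is the inclusion of words of length one. For a $G$-monoid $M$ (a $G$-space that is a topological monoid with $g(mn)=gm\cdot gn$), $BM$ is its classifying $G$-space, i.e. the geometric realization of the nerve of $M$ with $G$ acting through its action on $M$, and $\iota\colon\Sigma M\to BM$ is the natural $G$-map given by the inclusion of $1$-simplices. $\Sigma$ is reduced suspension with trivial action on the suspension coordinate. A $G$-map is a weak equivalence if it induces a weak equivalence on $H$-fixed point spaces for all (closed) subgroups $H$ of $G$. Basepoints are assumed nondegenerate throughout. *)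

(* Defs.v *)
From HB Require Import structures.
From Stdlib Require Import Relations.
From mathcomp Require Import all_boot all_order all_algebra generic_quotient.
From mathcomp Require Import all_classical all_reals all_analysis.
Import Order.TTheory GRing.Theory Num.Theory numFieldNormedType.Exports.

Set Implicit Arguments.
Unset Strict Implicit.
Unset Printing Implicit Defensive.

Local Open Scope classical_set_scope.
Local Open Scope ring_scope.
Local Open Scope quotient_scope.

(* As usual in equivariant homotopy theory, "space" means compactly generated
   weak Hausdorff space, and products carry the k-ification of the product
   topology: this is what makes the James construction a topological monoid
   and the realization of the nerve a G-space. *)

Section CompactlyGenerated.
Context {T : topologicalType}.

Definition kopen (A : set T) := forall (K : topologicalType) (u : K -> T),
  compact [set: K] -> hausdorff_space K -> continuous u -> open (u @^-1` A).

Definition compactly_generated := forall A : set T, kopen A -> open A.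

Definition weak_hausdorff := forall (K : topologicalType) (u : K -> T),
  compact [set: K] -> hausdorff_space K -> continuous u -> closed (range u).

Definition cgwh := compactly_generated /\ weak_hausdorff.

Lemma kopenT : kopen setT.
Proof. by move=> K u _ _ _; rewrite preimage_setT; exact: openT. Qed.

Lemma kopenI : setI_closed kopen.
Proof.
by move=> A B kA kB K u cK hK cu; rewrite preimage_setI;
  apply: openI; [exact: kA|exact: kB].
Qed.

Lemma kopen_bigU (I : Type) (f : I -> set T) :
  (forall i, kopen (f i)) -> kopen (\bigcup_i f i).
Proof.
move=> kf K u cK hK cu; rewrite preimage_bigcup; apply: bigcup_open => i _.
exact: kf.
Qed.

End CompactlyGenerated.
Arguments compactly_generated T : clear implicits.
Arguments weak_hausdorff T : clear implicits.
Arguments cgwh T : clear implicits.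

Definition kification (T : Type) : Type := T.

HB.instance Definition _ (T : topologicalType) :=
  Choice.copy (kification T) T.
HB.instance Definition _ (T : topologicalType) :=
  isOpenTopological.Build (kification T)
    (@kopenT T) (@kopenI T) (@kopen_bigU T).

Definition kprod (S T : Type) : Type := kification (S * T).
HB.instance Definition _ (S T : topologicalType) :=
  Topological.copy (kprod S T) (kification (S * T)).

Definition kpow (T : Type) (n : nat) : Type := kification {ptws 'I_n -> T}.
HB.instance Definition _ (T : topologicalType) (n : nat) :=
  Topological.copy (kpow T n) (kification {ptws 'I_n -> T}).

(* No compatibility is required between multiplication and topology: the nerve
   and its realization are defined from these data alone. *)
#[short(type="preTopologicalMonoidType")]
HB.structure Definition PreTopologicalMonoid := {M of Monoid M & Topological M}.

(* Multiplication is only required to be continuous on the k-product, and the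
   topology of a group is not required to be cgwh, so that this covers both
   group objects in cgwh spaces and topological groups in the plain sense. *)
HB.mixin Record isKTopologicalGroup G & Group G & Topological G := {
  mulg_kcontinuous : continuous (fun p : kprod G G => (p.1 * p.2)%g);
  invg_kcontinuous : continuous (fun g : G => (g^-1)%g)
}.

#[short(type="topGroupType")]
HB.structure Definition TopologicalGroup :=
  {G of Group G & Topological G & isKTopologicalGroup G}.

Section GSpaces.
Context {G : topGroupType}.

Definition is_gspace {X : topologicalType} (a : G -> X -> X) :=
  [/\ forall x, a 1%g x = x,
      forall g h x, a (g * h)%g x = a g (a h x) &
      continuous (fun p : kprod G X => a p.1 p.2)].

Definition equivariant {X Y : Type} (a : G -> X -> X) (b : G -> Y -> Y)
  (f : X -> Y) := forall g x, f (a g x) = b g (f x).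

Definition is_subgroup (H : set G) :=
  [/\ H 1%g, forall g h, H g -> H h -> H (g * h)%g &
      forall g, H g -> H (g^-1)%g].

Definition fixed_points {X : Type} (a : G -> X -> X) (H : set G) : set X :=
  [set x | forall h, H h -> a h x = x].

Lemma equivariant_fixed {X Y : Type} (a : G -> X -> X) (b : G -> Y -> Y)
    (f : X -> Y) (fe : equivariant a b f) (H : set G) (x : fixed_points a H) :
  f (set_val x) \in fixed_points b H.
Proof.
by apply: mem_set => h Hh; rewrite -fe; have -> := set_valP x h Hh.
Qed.

Definition fixed_map {X Y : Type} (a : G -> X -> X) (b : G -> Y -> Y)
    (f : X -> Y) (fe : equivariant a b f) (H : set G) :
    fixed_points a H -> fixed_points b H :=
  fun x => exist _ (f (set_val x)) (equivariant_fixed fe x).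

End GSpaces.

Section WeakEquivalence.
Context (R : realType).

Definition unit_interval : set R := [set t | 0 <= t <= 1].
Local Notation I := unit_interval.

Lemma unit_interval0 : 0 \in I.
Proof. by rewrite /unit_interval inE /= lexx ler01. Qed.
Lemma unit_interval1 : 1 \in I.
Proof. by rewrite /unit_interval inE /= lexx ler01. Qed.

Definition I0 : I := exist _ 0 unit_interval0.
Definition I1 : I := exist _ 1 unit_interval1.

Definition cube (n : nat) : set {ptws 'I_n -> R} :=
  [set s | forall i, 0 <= s i <= 1].
Arguments cube n : clear implicits.

Definition cube_boundary (n : nat) : set (cube n) :=
  [set s | exists i, set_val s i = 0 \/ set_val s i = 1].

Context {X Y : topologicalType}.

Definition path_related (Z : topologicalType) (x y : Z) :=
  exists2 c : I -> Z, continuous c & c I0 = x /\ c I1 = y.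

(* Representatives (I^n, dI^n) -> (Z, z) of the elements of pi_n(Z, z), and
   homotopy of such maps relative to dI^n. *)
Definition spheroid (Z : topologicalType) (n : nat) (z : Z)
    (u : cube n -> Z) :=
  continuous u /\ forall s, cube_boundary s -> u s = z.

Definition spheroid_homotopic (Z : topologicalType) (n : nat) (z : Z)
    (u v : cube n -> Z) :=
  exists2 h : cube n * I -> Z, continuous h &
    [/\ forall s, h (s, I0) = u s, forall s, h (s, I1) = v s &
        forall s t, cube_boundary s -> h (s, t) = z].

(* Bijectivity on path components, and on pi_n for all n > 0 and all base
   points; the maps induced on pi_n are automatically homomorphisms. *)
Definition weak_equivalence (f : X -> Y) :=
  [/\ continuous f,
      forall x x', path_related (f x) (f x') -> path_related x x',
      forall y, exists x, path_related (f x) y,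
      forall n (x : X) (u v : cube n -> X), (0 < n)%N ->
        spheroid x u -> spheroid x v ->
        spheroid_homotopic (f x) (f \o u) (f \o v) ->
        spheroid_homotopic x u v &
      forall n (x : X) (w : cube n -> Y), (0 < n)%N -> spheroid (f x) w ->
        exists2 u : cube n -> X,
          spheroid x u & spheroid_homotopic (f x) (f \o u) w].

End WeakEquivalence.
Arguments unit_interval R : clear implicits.
Arguments cube R n : clear implicits.

Definition g_weak_equivalence (R : realType) (G : topGroupType)
    (X Y : topologicalType) (a : G -> X -> X) (b : G -> Y -> Y) (f : X -> Y) :=
  continuous f /\
  exists fe : equivariant a b f, forall H : set G,
    is_subgroup H -> closed H -> weak_equivalence R (fixed_map fe (H := H)).

(* The inclusion of the fixed basepoint is a G-cofibration: it has the homotopy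
   extension property with respect to all G-spaces. A G-homotopy on the
   one-point space is a path of fixed points. *)
Definition nondegenerately_based (R : realType) (G : topGroupType)
    (X : topologicalType) (a : G -> X -> X) (x0 : X) :=
  forall (Z : topologicalType) (b : G -> Z -> Z) (f : X -> Z)
    (c : unit_interval R -> Z),
    cgwh Z -> is_gspace b -> continuous f -> equivariant a b f ->
    continuous c -> (forall g t, b g (c t) = c t) -> c (I0 R) = f x0 ->
  exists h : kprod X (unit_interval R) -> Z,
    [/\ continuous h, forall g x t, h (a g x, t) = b g (h (x, t)),
        forall x, h (x, I0 R) = f x & forall t, h (x0, t) = c t].

Section Suspension.
Context (R : realType).
Local Notation I := (unit_interval R).

Section Def.
Context {X : topologicalType} (x0 : X).

Definition collapsed (p : kprod X I) : bool :=
  [|| p.1 == x0, set_val p.2 == 0 | set_val p.2 == 1].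

Definition susp_rel_def (p q : kprod X I) : bool :=
  (p == q) || (collapsed p && collapsed q).

Lemma susp_rel_refl : reflexive susp_rel_def.
Proof. by move=> p; rewrite /susp_rel_def eqxx. Qed.

Lemma susp_rel_sym : symmetric susp_rel_def.
Proof. by move=> p q; rewrite /susp_rel_def eq_sym andbC. Qed.

Lemma susp_rel_trans : transitive susp_rel_def.
Proof.
move=> q p r /predU1P[->//|/andP[cp cq]] /predU1P[<-|/andP[_ cr]].
  by rewrite /susp_rel_def cp cq orbT.
by rewrite /susp_rel_def cp cr orbT.
Qed.

Definition susp_rel := EquivRel _ susp_rel_refl susp_rel_sym susp_rel_trans.

Definition susp := {eq_quot susp_rel}.
HB.instance Definition _ := Topological.copy susp (quotient_topology susp).
HB.instance Definition _ := Quotient.on susp.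

Definition susp_pi : kprod X I -> susp := \pi_susp.

Lemma susp_piP (p q : kprod X I) :
  reflect (susp_pi p = susp_pi q) (susp_rel_def p q).
Proof. exact: eqmodP. Qed.

End Def.

(* The maps defined below on quotients through repr are independent of the
   chosen representatives: see susp_mapE, classifying_mapE and iotaBE. *)
Definition susp_map (X Y : topologicalType) (x0 : X) (y0 : Y) (f : X -> Y)
  (q : susp x0) : susp y0 := susp_pi y0 (f (repr q).1, (repr q).2).

Lemma susp_mapE (X Y : topologicalType) (x0 : X) (y0 : Y) (f : X -> Y) x t :
  f x0 = y0 -> susp_map y0 f (susp_pi x0 (x, t)) = susp_pi y0 (f x, t).
Proof.
move=> f0; have : susp_pi x0 (repr (susp_pi x0 (x, t))) = susp_pi x0 (x, t).
  exact: reprK.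
rewrite /susp_map; case: (repr _) => x' t' /susp_piP /predU1P[[-> ->]//|].
move=> /andP[c c']; apply/susp_piP; rewrite /susp_rel_def; apply/orP; right.
apply/andP; split; move: c c'; rewrite /collapsed /=.
  by case/orP=> [/eqP ->|->]; rewrite ?f0 ?eqxx ?orbT.
by move=> _ /orP[/eqP ->|->]; rewrite ?f0 ?eqxx ?orbT.
Qed.

Definition susp_act (G : topGroupType) (X : topologicalType)
    (a : G -> X -> X) (x0 : X) (g : G) : susp x0 -> susp x0 :=
  susp_map x0 (a g).

End Suspension.

(* The James construction: its points are the words without occurrence of the
   basepoint, presented as the quotient of the disjoint union of the X^n by the
   map deleting all occurrences of the basepoint. *)
Section James.

Section Def.
Context {X : topologicalType} (x0 : X).

Record reduced_word := ReducedWord {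
  letters : seq X;
  _ : x0 \notin letters
}.

HB.instance Definition _ := [isSub for letters].

Definition word_space (n : nat) : topologicalType := kpow X n.

Lemma reduce_subproof (s : seq X) : x0 \notin [seq x <- s | x != x0].
Proof. by rewrite mem_filter eqxx. Qed.

Definition reduce (s : seq X) : reduced_word :=
  ReducedWord (reduce_subproof s).

Definition word_reduce (w : {n & word_space n}) : reduced_word :=
  reduce [seq projT2 w i | i <- enum 'I_(projT1 w)].

Definition word_repr (w : reduced_word) : {n & word_space n} :=
  existT word_space (size (letters w)) (fun i => tnth (in_tuple (letters w)) i).

Lemma reduce_letters w : reduce (letters w) = w.
Proof.
apply/val_inj => /=; case: w => s /= x0s; apply/all_filterP/allP => x xs.
by apply: contraNneq x0s => <-.
Qed.

Lemma word_reprK : cancel word_repr word_reduce.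
Proof.
move=> w; rewrite /word_reduce /= -[RHS]reduce_letters; congr reduce.
exact: (map_tnth_enum (in_tuple (letters w))).
Qed.

HB.instance Definition _ :=
  isQuotient.Build {n & word_space n} reduced_word word_reprK.

Definition james := quotient_topology reduced_word.
HB.instance Definition _ := Topological.on james.

Lemma james_openE (A : set james) : open A = open (word_reduce @^-1` A).
Proof.
rewrite {1}/open /= /quotient_open /=; congr (open (_ @^-1` A)).
by apply/funext => w; rewrite unlock.
Qed.

Definition jword (s : seq X) : james := reduce s.
Definition jletters (w : james) : seq X := letters w.

Lemma jlettersK : cancel jletters jword.
Proof. exact: reduce_letters. Qed.

Lemma jwordK s : jletters (jword s) = [seq x <- s | x != x0].
Proof. by []. Qed.

Definition jmul (v w : james) : james := jword (jletters v ++ jletters w).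

Lemma jword_cat s t : jword (s ++ t) = jmul (jword s) (jword t).
Proof.
apply: (can_inj jlettersK).
by rewrite /jmul !jwordK !filter_cat !filter_id.
Qed.

Lemma jmulA : associative jmul.
Proof.
move=> u v w; rewrite -(jlettersK u) -(jlettersK v) -(jlettersK w).
by rewrite -!jword_cat catA.
Qed.

Lemma jmul1 : left_id (jword [::]) jmul.
Proof. by move=> u; rewrite -(jlettersK u) -jword_cat. Qed.

Lemma jmulr1 : right_id (jword [::]) jmul.
Proof. by move=> u; rewrite -(jlettersK u) -jword_cat cats0. Qed.

HB.instance Definition _ := isMonoid.Build james jmulA jmul1 jmulr1.

Definition james_unit (x : X) : james := jword [:: x].

Definition james_map (f : X -> X) (w : james) : james :=
  jword [seq f x | x <- jletters w].

Lemma james_mapE f s : f x0 = x0 ->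
  james_map f (jword s) = jword [seq f x | x <- s].
Proof.
move=> f0; apply: (can_inj jlettersK); rewrite /james_map !jwordK.
elim: s => //= x s IHs; case: (eqVneq x x0) => [->|xx0] /=.
  by rewrite f0 eqxx.
by rewrite IHs.
Qed.

Lemma james_map_monoid f : f x0 = x0 ->
  james_map f 1%g = 1%g /\ {morph james_map f : v w / (v * w)%g}.
Proof.
move=> f0; split; first by rewrite james_mapE.
move=> v w; rewrite -(jlettersK v) -(jlettersK w) -[(_ * _)%g]jword_cat.
by rewrite !james_mapE// map_cat jword_cat.
Qed.

End Def.

Definition james_act (G : topGroupType) (X : topologicalType)
    (a : G -> X -> X) (x0 : X) (g : G) : james x0 -> james x0 :=
  james_map (a g).

End James.

HB.instance Definition _ (X : topologicalType) (x0 : X) :=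
  Monoid.on (james x0).

Section ClassifyingSpace.
Context (R : realType).

Definition simplex (p : nat) : set {ptws 'I_p.+1 -> R} :=
  [set u | (forall i, 0 <= u i) /\ \sum_i u i = 1].
Arguments simplex p : clear implicits.

Definition monotone (q p : nat) (phi : 'I_q.+1 -> 'I_p.+1) :=
  {homo phi : i j / (i <= j)%N}.

Lemma simplex_map_subproof q p (phi : 'I_q.+1 -> 'I_p.+1) (v : simplex q) :
  ((fun i => \sum_(j | phi j == i) set_val v j) : {ptws 'I_p.+1 -> R})
    \in simplex p.
Proof.
apply: mem_set; have [v0 v1] := set_valP v; split.
  by move=> i; apply: sumr_ge0 => j _; exact: v0.
by rewrite -v1 (partition_big phi xpredT).
Qed.

Definition simplex_map q p (phi : 'I_q.+1 -> 'I_p.+1) (v : simplex q) :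
  simplex p := exist (fun u => u \in simplex p) _ (simplex_map_subproof phi v).

(* An element m of M^p is a functor from the ordinal [p] to M viewed as a
   category with one object, m k being the image of the arrow k -> k + 1;
   the simplicial structure is precomposition with monotone maps. *)
Definition nerve_map (M : preTopologicalMonoidType) q p
    (phi : 'I_q.+1 -> 'I_p.+1) (m : kpow M p) : kpow M q :=
  fun j => \big[*%g/1%g]_(k < p |
    (phi (widen_ord (leqnSn q) j) <= k < phi (lift ord0 j))%N) m k.

Definition cell (M : preTopologicalMonoidType) (p : nat) : topologicalType :=
  kprod (kpow M p) (simplex p).

Definition mkcell (M : preTopologicalMonoidType) p (m : kpow M p)
  (u : simplex p) : {p & cell M p} := existT (cell M) p (m, u).

Section Def.
Context (M : preTopologicalMonoidType).

Inductive glue : {p & cell M p} -> {p & cell M p} -> Prop :=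
  Glue q p (phi : 'I_q.+1 -> 'I_p.+1) (m : kpow M p) (v : simplex q) :
    monotone phi ->
    glue (mkcell (nerve_map phi m) v) (mkcell m (simplex_map phi v)).

Definition realization_rel_def (x y : {p & cell M p}) : bool :=
  `[< clos_refl_sym_trans _ glue x y >].

Lemma realization_rel_refl : reflexive realization_rel_def.
Proof. by move=> x; apply/asboolP; exact: rst_refl. Qed.

Lemma realization_rel_sym : symmetric realization_rel_def.
Proof.
by move=> x y; apply/idP/idP => /asboolP h; apply/asboolP; exact: rst_sym.
Qed.

Lemma realization_rel_trans : transitive realization_rel_def.
Proof.
move=> y x z /asboolP xy /asboolP yz; apply/asboolP; exact: rst_trans yz.
Qed.

Definition realization_rel := EquivRel _
  realization_rel_refl realization_rel_sym realization_rel_trans.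

Definition classifying := {eq_quot realization_rel}.
HB.instance Definition _ :=
  Topological.copy classifying (quotient_topology classifying).
HB.instance Definition _ := Quotient.on classifying.

Definition classifying_pi : {p & cell M p} -> classifying := \pi_classifying.

Lemma classifying_piP x y :
  classifying_pi x = classifying_pi y <-> clos_refl_sym_trans _ glue x y.
Proof.
split=> [/eqmodP/asboolP//|h]; apply/eqmodP; exact/asboolP.
Qed.

Lemma classifying_glue q p (phi : 'I_q.+1 -> 'I_p.+1) m v : monotone phi ->
  classifying_pi (mkcell (nerve_map phi m) v) =
  classifying_pi (mkcell m (simplex_map phi v)).
Proof. by move=> hphi; apply/classifying_piP; apply: rst_step. Qed.

(* The suspension coordinate t is the barycentric coordinate of vertex 1. *)
Lemma edge_subproof (t : unit_interval R) :
  ((fun i : 'I_2 => if i == ord0 then 1 - set_val t else set_val t)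
     : {ptws 'I_2 -> R}) \in simplex 1.
Proof.
apply: mem_set; have /= /andP[t0 t1] := set_valP t; split.
  by move=> i; case: ifP => _ //; rewrite subr_ge0.
by rewrite big_ord_recl big_ord1 /= subrK.
Qed.

Definition edge (t : unit_interval R) : simplex 1 :=
  exist (fun u => u \in simplex 1) _ (edge_subproof t).

Definition edge_cell (m : M) (t : unit_interval R) : {p & cell M p} :=
  mkcell ((fun=> m) : kpow M 1) (edge t).

Definition iotaB (q : susp R (1%g : M)) : classifying :=
  classifying_pi (edge_cell (repr q).1 (repr q).2).

End Def.

Definition classifying_map (M N : preTopologicalMonoidType) (f : M -> N)
    (q : classifying M) : classifying N :=
  classifying_pi (mkcell ((f \o (projT2 (repr q)).1) : kpow N _)
                         (projT2 (repr q)).2).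

Lemma classifying_mapE (M N : preTopologicalMonoidType) (f : M -> N)
    p (m : kpow M p) (u : simplex p) :
  f 1%g = 1%g -> {morph f : x y / (x * y)%g} ->
  classifying_map f (classifying_pi (mkcell m u)) =
  classifying_pi (mkcell (f \o m : kpow N p) u).
Proof.
move=> f1 fM.
pose F (x : {p & cell M p}) : {p & cell N p} :=
  mkcell ((f \o (projT2 x).1) : kpow N _) (projT2 x).2.
have FP x y : clos_refl_sym_trans _ (@glue M) x y ->
    classifying_pi (F x) = classifying_pi (F y).
  elim=> {x y} [x y|//|x y _ ->//|x y z _ -> _ ->//].
  case=> q r phi n v hphi; rewrite /F /= -classifying_glue//.
  congr (classifying_pi (mkcell _ v)); apply/funext => j /=.
  by rewrite /nerve_map (big_morph f fM f1).
apply: (FP _ (mkcell m u)); apply/classifying_piP; exact: reprK.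
Qed.

Definition classifying_act (G : topGroupType) (M : preTopologicalMonoidType)
    (b : G -> M -> M) (g : G) : classifying M -> classifying M :=
  classifying_map (b g).

Lemma simplex0E (v : simplex 0) i : set_val v i = 1.
Proof. by rewrite (ord1 i); have [_] := set_valP v; rewrite big_ord1. Qed.

Lemma simplex0_eq (u v : simplex 0) : u = v.
Proof.
apply/val_inj/funext => i.
exact: etrans (simplex0E u i) (esym (simplex0E v i)).
Qed.

Lemma edge_collapsed (M : preTopologicalMonoidType) (m : M) t (v : simplex 0) :
  collapsed (1%g : M) (m, t) ->
  classifying_pi (edge_cell m t) =
  classifying_pi (mkcell ((fun=> 1%g) : kpow M 0) v).
Proof.
have endE (i0 : 'I_2) : (forall i, set_val (edge t) i = (i == i0)%:R) ->
    classifying_pi (edge_cell m t) =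
    classifying_pi (mkcell ((fun=> 1%g) : kpow M 0) v).
  move=> ti.
  have -> : (fun=> 1%g) = nerve_map (fun=> i0) ((fun=> m) : kpow M 1)
    :> kpow M 0 by apply/funext => -[].
  rewrite classifying_glue//; congr (classifying_pi (mkcell _ _)).
  apply/val_inj/funext => i.
  transitivity (set_val (edge t) i); first by [].
  rewrite ti /= big_mkcond big_ord1 simplex0E eq_sym.
  by case: eqP.
rewrite /collapsed => /or3P[/eqP/= ->|/eqP/= t0|/eqP/= t1].
- rewrite (simplex0_eq v (simplex_map (fun=> ord0) (edge t))).
  rewrite -classifying_glue//; congr (classifying_pi (mkcell _ _)).
  by apply/funext => j; rewrite /nerve_map big_ord0.
- apply: (endE ord0) => i; rewrite set_valE /= t0 subr0.
  by case: ifP.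
- apply: (endE ord_max) => i; rewrite set_valE /= t1 subrr.
  by case: i => -[|[|]].
Qed.

Lemma iotaBE (M : preTopologicalMonoidType) (m : M) t :
  iotaB (susp_pi (1%g : M) (m, t)) = classifying_pi (edge_cell m t).
Proof.
have : susp_pi (1%g : M) (repr (susp_pi (1%g : M) (m, t))) =
       susp_pi (1%g : M) (m, t) by exact: reprK.
rewrite /iotaB; case: (repr _) => m' t' /susp_piP /predU1P[[-> ->]//|].
move=> /andP[c c'] /=.
have v : simplex 0 := simplex_map (fun=> ord0) (edge t).
by rewrite !(edge_collapsed v).
Qed.

End ClassifyingSpace.
Arguments simplex R p : clear implicits.

(* Main.v *)
(* A point of [B (M X)] is a word [x_1 ... x_n] in [X] together with a point of
   the simplex [Delta^n]; letters equal to the basepoint may be deleted (a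
   degeneracy), and only the two outer faces of [Delta^n] identify it with
   simplices of shorter words.  [Susp X] is the part carried by the spine of
   [Delta^n], the path formed by the edges joining consecutive vertices.

   Nondegeneracy of the basepoint provides an invariant weight [w : X -> R>=0]
   that vanishes exactly at the basepoint.  The affine map [Delta^n -> R] that
   sends the [j]-th vertex to [w x_1 + ... + w x_j] restricts to a bijection of
   the spine onto [0, w x_1 + ... + w x_n] when no letter is the basepoint, and
   moving each point along a straight line to the spine point with the same
   image is compatible with all identifications.  It is an equivariant strong
   deformation retraction of [B (M X)] onto [Susp X], so it restricts to fixed
   points. *)
Require Import Defs.
From Stdlib Require Import Relations.
From mathcomp Require Import all_boot all_order all_algebra generic_quotient.
From mathcomp Require Import all_classical all_reals all_analysis.
From mathcomp Require Import zify ring.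
Import Order.TTheory GRing.Theory Num.Theory numFieldNormedType.Exports.

Set Implicit Arguments.
Unset Strict Implicit.
Unset Printing Implicit Defensive.

Local Open Scope classical_set_scope.
Local Open Scope ring_scope.
Local Open Scope quotient_scope.

(** * Compactly generated spaces *)

(** Steps of equal length in place of the weights would not survive the deletion of a basepoint
    letter; a weight gives such a letter a step of length zero. Compatibility with the remaining
    identifications rests on freeness: between cells whose entries are single letters, the target
    word being reduced, a vertex map never merges two letters, so no inner face occurs, and an outer
    face changes the affine map only by a constant.

    The obstacle is at words with basepoint letters: there the affine map collapses an edge of the
    spine, so the spine point is neither unique nor continuous in the word, although its class in
    the suspension and its track in [B] are. The spine point is therefore handled as a relation,
    shown single-valued on reduced words, and continuity follows from a closed graph over a compact
    parameter space.

    The topology of [B] is a quotient of k-products of [J], and [J] is itself a quotient of powers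
    of [X]. Continuity is tested on compact Hausdorff parameter spaces, where k-ification is
    invisible, after lifting every entry to letters that vary continuously. *)

Definition compact_hausdorff (K : topologicalType) :=
  compact [set: K] /\ hausdorff_space K.

Lemma continuous_pair (T U V : topologicalType) (f : T -> U) (g : T -> V) :
  continuous f -> continuous g -> continuous (fun x => (f x, g x)).
Proof. by move=> cf cg x; apply: cvg_pair; [exact: cf|exact: cg]. Qed.

Lemma continuous_fst (T U : topologicalType) : continuous (@fst T U).
Proof. by move=> x; exact: cvg_fst. Qed.

Lemma continuous_snd (T U : topologicalType) : continuous (@snd T U).
Proof. by move=> x; exact: cvg_snd. Qed.

Lemma continuous_idfun (T : topologicalType) : continuous (fun x : T => x).
Proof. by move=> x; exact: cvg_id. Qed.

Lemma continuous_comp_fun (T U V : topologicalType) (f : T -> U) (g : U -> V) :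
  continuous f -> continuous g -> continuous (fun x => g (f x)).
Proof. by move=> cf cg x; apply: continuous_comp; [exact: cf|exact: cg]. Qed.

Lemma continuous_set_val (T : topologicalType) (A : set T) :
  continuous (fun x : A => set_val x).
Proof. exact: initial_continuous. Qed.

Lemma continuous_into_set (S T : topologicalType) (A : set T) (f : S -> A) :
  continuous (fun x => set_val (f x)) -> continuous f.
Proof.
move=> /continuousP cf; apply/continuousP => _ [B oB <-].
exact: (cf B oB).
Qed.

Lemma continuous_into_ptws (S T : topologicalType) (I : Type)
    (f : S -> {ptws I -> T}) :
  (forall i, continuous (fun x => f x i)) -> continuous f.
Proof.
move=> cf x; apply/cvg_sup => i U [V [[W oW <-] Wx] WU].
apply: filterS WU _; apply: (cf i x); exact: open_nbhs_nbhs.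
Qed.

Lemma continuous_ptws_eval (T : topologicalType) (I : eqType) (i : I) :
  continuous (fun f : {ptws I -> T} => f i).
Proof. exact: (@proj_continuous I (fun=> T) i). Qed.

Lemma compact_hausdorff_prod (K L : topologicalType) :
  compact_hausdorff K -> compact_hausdorff L ->
  compact_hausdorff (K * L)%type.
Proof.
move=> [cK hK] [cL hL]; split.
  rewrite -setXTT; exact: compact_setX.
move=> [a b] [c d] cl; congr pair.
  apply: hK => A B nA nB.
  have nA' : nbhs (a, b) (fst @^-1` A) := @continuous_fst K L (a, b) A nA.
  have nB' : nbhs (c, d) (fst @^-1` B) := @continuous_fst K L (c, d) B nB.
  by have [[u v] [Au Bu]] := cl _ _ nA' nB'; exists u.
apply: hL => A B nA nB.
have nA' : nbhs (a, b) (snd @^-1` A) := @continuous_snd K L (a, b) A nA.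
have nB' : nbhs (c, d) (snd @^-1` B) := @continuous_snd K L (c, d) B nB.
by have [[u v] [Av Bv]] := cl _ _ nA' nB'; exists v.
Qed.

Section Kification.

Lemma kification_openE (T : topologicalType) (A : set T) :
  open (A : set (kification T)) = kopen A.
Proof. by []. Qed.

Lemma continuous_kification_id (T : topologicalType) :
  continuous (id : kification T -> T).
Proof.
apply/continuousP => A oA; rewrite kification_openE => K u _ _ /continuousP cu.
exact: cu.
Qed.

Lemma continuous_into_kification (K T : topologicalType) (f : K -> T) :
  compact_hausdorff K -> continuous f -> continuous (f : K -> kification T).
Proof.
move=> [cK hK] cf; apply/continuousP => A; rewrite kification_openE => kA.
exact: kA.
Qed.

Lemma continuous_from_cg (S T : topologicalType) (f : S -> T) :
  compactly_generated S -> 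
  (forall (K : topologicalType) (u : K -> S), compact_hausdorff K ->
     continuous u -> continuous (f \o u)) ->
  continuous f.
Proof.
move=> cg cf; apply/continuousP => A oA; apply: cg => K u cK hK cu.
by have /continuousP/(_ A oA) := cf K u (conj cK hK) cu.
Qed.

(** Every test map into [T] is also a test map into [kification T], so k-ifying a second time adds
    no open set. *)
Lemma kification_cg (T : topologicalType) : compactly_generated (kification T).
Proof.
move=> A kA; rewrite kification_openE => K u cK hK cu; apply: kA => //.
exact: continuous_into_kification.
Qed.

Lemma continuous_into_kification_cg (S T : topologicalType) (f : S -> T) :
  compactly_generated S -> continuous f ->
  continuous (f : S -> kification T).
Proof.
move=> cg cf; apply: continuous_from_cg => // K u cK cu.
apply: continuous_into_kification => //.
exact: continuous_comp_fun.
Qed.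

Lemma continuous_kprod_id (S T : topologicalType) :
  continuous (id : kprod S T -> S * T).
Proof. exact: continuous_kification_id. Qed.

Lemma continuous_kprod_fst (S T : topologicalType) :
  continuous (fun p : kprod S T => p.1).
Proof.
exact: (continuous_comp_fun (@continuous_kprod_id S T) (@continuous_fst S T)).
Qed.

Lemma continuous_kprod_snd (S T : topologicalType) :
  continuous (fun p : kprod S T => p.2).
Proof.
exact: (continuous_comp_fun (@continuous_kprod_id S T) (@continuous_snd S T)).
Qed.

Lemma continuous_into_kprod (K S T : topologicalType)
    (f : K -> S) (g : K -> T) :
  compact_hausdorff K -> continuous f -> continuous g ->
  continuous (fun k => (f k, g k) : kprod S T).
Proof.
move=> cK cf cg; apply: continuous_into_kification cK _.
exact: continuous_pair.
Qed.

Lemma continuous_into_kpow (K T : topologicalType) n (f : 'I_n -> K -> T) :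
  compact_hausdorff K -> (forall i, continuous (f i)) ->
  continuous (fun k => f ^~ k : kpow T n).
Proof.
move=> cK cf; apply: continuous_into_kification cK _.
exact: continuous_into_ptws.
Qed.

Lemma continuous_kpow_eval (T : topologicalType) n (i : 'I_n) :
  continuous (fun f : kpow T n => f i).
Proof.
exact: (continuous_comp_fun (@continuous_kification_id {ptws 'I_n -> T})
  (@continuous_ptws_eval T _ i)).
Qed.

Lemma continuous_kification_val (T : topologicalType) (A : set T) :
  continuous (fun z : kification A => set_val (z : A)).
Proof.
exact: (continuous_comp_fun (@continuous_kification_id A)
  (@continuous_set_val T A)).
Qed.

End Kification.

(** The tube lemma. *)
Lemma tube_open (L K : topologicalType) (N : set K) (O : set (L * K)) :
  compact N -> open O -> open [set l | forall k, N k -> O (l, k)].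
Proof.
move=> /compact_near_coveringP cN oO; rewrite openE => l0 /= Ol0.
have := cN L (nbhs l0) (fun l k => O (l, k)) _; apply => k Nk.
have : nbhs (l0, k) O by apply: open_nbhs_nbhs; split=> //; exact: Ol0.
case=> -[U V] /= [nU nV] UV; exists (V, U) => // -[x y] /= [Vx Uy].
exact: UV.
Qed.

(* Whitehead's theorem on products with compact Hausdorff spaces, for a jointly
   surjective and jointly quotient family of maps. *)
Lemma open_prod_quotient (J : Type) (E : J -> topologicalType)
    (M K : topologicalType) (q : forall j, E j -> M) (W : set (M * K)) :
  (forall j, compactly_generated (E j)) ->
  (forall m, exists j e, q j e = m) ->
  (forall A : set M, (forall j, open (q j @^-1` A)) -> open A) ->
  compact_hausdorff K ->
  (forall j, kopen [set p : E j * K | W (q j p.1, p.2)]) ->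
  open W.
Proof.
move=> cgE qsurj qquot [cK hK] kW.
have sliceo m : open [set k | W (m, k)].
  have [j [e <-]] := qsurj m.
  apply: (kW j K (fun k => (e, k))) => //.
  by apply: continuous_pair => x; [exact: cvg_cst|exact: cvg_id].
rewrite openE => -[m0 k0] Wmk.
have nbk0 : nbhs k0 [set k | W (m0, k)].
  by apply: open_nbhs_nbhs; split => //; exact: sliceo.
have := @compact_regular K k0 setT hK cK filterT _ nbk0.
move=> [N nN NW].
pose C := closure N.
have cC : compact C.
  by apply: (subclosed_compact _ cK) => //; exact: closed_closure.
(* [V] is to be a neighbourhood of [m0] with [V * C] inside [W]. Its openness is checked on the
   pullback to a compact Hausdorff [L], where the tube lemma applies. *)
pose V := [set m | forall k, C k -> W (m, k)].
have oV : open V.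
  apply: qquot => j; apply: cgE => L v cL hL cv.
  pose O := [set p : L * K | W (q j (v p.1), p.2)].
  have oO : open O.
    have [cLK hLK] := compact_hausdorff_prod (conj cL hL) (conj cK hK).
    apply: (kW j (L * K)%type (fun p => (v p.1, p.2))) => //.
    apply: continuous_pair; last exact: continuous_snd.
    by apply: continuous_comp_fun cv; exact: continuous_fst.
  exact: (tube_open cC oO).
exists (V, N) => /=.
  by split => //; apply: open_nbhs_nbhs.
by move=> [m k] /= [Vm Nk]; apply: Vm; apply: subset_closure.
Qed.

(* [f] is continuous as soon as it is a union of continuous functions of an
   auxiliary parameter which ranges over a compact space and satisfies a closed
   condition: no continuous choice of the parameter is required. *)
Lemma continuous_multivalued (J : finType) (K C T : topologicalType)
    (Gam : J -> set (K * C)) (g : J -> K * C -> T) (f : K -> T) :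
  compact_hausdorff K -> compact_hausdorff C ->
  (forall j, closed (Gam j)) -> (forall j, continuous (g j)) ->
  (forall k, exists j c, Gam j (k, c)) ->
  (forall j k c, Gam j (k, c) -> f k = g j (k, c)) ->
  continuous f.
Proof.
move=> cK cC clG cg tot fE; apply/continuous_closedP => D clD.
have [cKC hKC] := compact_hausdorff_prod cK cC.
(* The preimage of a closed set is a finite union of projections, along the compact [C], of closed
   subsets of [K * C]. *)
rewrite (_ : _ @^-1` _ = \bigcup_(j in [set: J])
    (fst @` (Gam j `&` g j @^-1` D))).
  apply: closed_bigcup; first exact: finite_finset.
  move=> j _; apply: compact_closed; first exact: cK.2.
  apply: continuous_compact.
    apply: continuous_subspaceT; exact: continuous_fst.
  apply: (subclosed_compact _ cKC) => //; apply: closedI; first exact: clG.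
  by move/continuous_closedP: (cg j); exact.
apply/seteqP; split=> k /=.
  move=> Dfk; have [j [c Gc]] := tot k; exists j => //; exists (k, c) => //.
  by split=> //=; rewrite -(fE _ _ _ Gc).
by move=> [j _ [[k' c] [Gc /= Dg] <-]] /=; rewrite (fE _ _ _ Gc).
Qed.

(* To test openness along a map from a compact Hausdorff space into a power of
   [M], one may lift the coordinates to the [E j] one at a time. *)
Lemma open_lift_coordinates (J : Type) (E : J -> topologicalType)
    (M Z : topologicalType) (q : forall j, E j -> M) (p : nat)
    (A : ('I_p -> M) -> Z -> Prop) :
  (forall j, compactly_generated (E j)) ->
  (forall m, exists j e, q j e = m) ->
  (forall A : set M, (forall j, open (q j @^-1` A)) -> open A) ->
  (forall j, continuous (q j)) ->
  (forall (K : topologicalType) (n : 'I_p -> J)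
     (w : forall i, K -> E (n i)) (z : K -> Z),
     compact_hausdorff K -> (forall i, continuous (w i)) -> continuous z ->
     open [set k | A (fun i => q (n i) (w i k)) (z k)]) ->
  forall (K : topologicalType) (m : 'I_p -> K -> M) (z : K -> Z),
    compact_hausdorff K -> (forall i, continuous (m i)) -> continuous z ->
    open [set k | A (m ^~ k) (z k)].
Proof.
move=> cgE qsurj qquot qcont H.
(* Induction on the number [i] of leading coordinates that may still lack a lift. *)
suff P : forall i (K : topologicalType) (m : 'I_p -> K -> M) (z : K -> Z),
    compact_hausdorff K -> (forall j, continuous (m j)) -> continuous z ->
    (forall j : 'I_p, (i <= j)%N -> exists n (w : K -> E n),
      continuous w /\ forall k, m j k = q n (w k)) ->
    open [set k | A (m ^~ k) (z k)].
  move=> K m z cK cm cz; apply: (P p) => // j.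
  by rewrite leqNgt ltn_ord.
elim=> [|i IHi] K m z cK cm cz lift.
  have /choice[n Hn] : forall j, exists n, exists (w : K -> E n),
      continuous w /\ forall k, m j k = q n (w k) by move=> j; exact: lift.
  pose w j := projT1 (cid (Hn j)).
  have wP j : continuous (w j) /\ forall k, m j k = q (n j) (w j k).
    by rewrite /w; case: cid.
  rewrite (_ : [set k | _] = [set k | A (fun i => q (n i) (w i k)) (z k)]).
    by apply: H => // j; case: (wP j).
  apply/funext => k /=; congr (A _ _); apply/funext => j.
  by case: (wP j) => _ ->.
have [pi|ip] := leqP p i.
  apply: (IHi) => // j ij; apply: lift.
  by have := leq_trans pi ij; rewrite leqNgt ltn_ord.
pose i0 := Ordinal ip.
(* The coordinate [i0] becomes a free variable in [M]: by Whitehead's theorem the resulting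
   condition is open in [M * K], and it is then pulled back along [k |-> (m i0 k, k)]. *)
pose upd (x : M) (k : K) := fun j => if j == i0 then x else m j k.
pose W := [set xk : M * K | A (upd xk.1 xk.2) (z xk.2)].
have oW : open W.
  apply: (@open_prod_quotient J E M K q) => // j L u cL hL cu.
  have cu1 := continuous_comp_fun cu (@continuous_fst (E j) K).
  have cu2 := continuous_comp_fun cu (@continuous_snd (E j) K).
  pose m' l (b : L) := if l == i0 then q j (u b).1 else m l (u b).2.
  rewrite (_ : _ @^-1` _ = [set b | A (m' ^~ b) (z (u b).2)]) //.
  apply: (IHi) => //.
  - move=> l; rewrite /m'; case: eqP => _.
      exact: (continuous_comp_fun cu1).
    exact: (continuous_comp_fun cu2).
  - exact: (continuous_comp_fun cu2).
  - move=> l il; case: (eqVneq l i0) => [->|li].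
      by exists j, (fst \o u); rewrite /m' eqxx.
    have il' : (i < l)%N by rewrite ltn_neqAle il andbT eq_sym.
    have [n [w [cw mw]]] := lift l il'.
    exists n, (w \o (snd \o u)); split; first exact: (continuous_comp_fun cu2).
    by move=> b; rewrite /m' (negbTE li) mw.
rewrite (_ : [set k | _] = (fun k => (m i0 k, k)) @^-1` W).
  apply: open_comp => // k _; apply: continuous_pair; first exact: cm.
  by move=> ?; exact: cvg_id.
apply/funext => k /=; congr (A _ _); apply/funext => j; rewrite /upd.
by case: eqP => [->|].
Qed.

Lemma hausdorff_injective (S T : topologicalType) (f : S -> T) :
  continuous f -> injective f -> hausdorff_space T -> hausdorff_space S.
Proof.
move=> cf fi hT x y cl; apply/fi/hT => A B nA nB.
by have [z [Az Bz]] := cl _ _ (cf x A nA) (cf y B nB); exists (f z).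
Qed.

Lemma set_val_inj (T : Type) (A : set T) : injective (fun x : A => set_val x).
Proof. by move=> x y; rewrite set_valE; exact: (@val_inj _ _ _ x y). Qed.

Lemma compact_hausdorff_set (T : topologicalType) (A : set T) :
  hausdorff_space T -> compact A -> compact_hausdorff A.
Proof.
move=> hT cA; split; last first.
  exact: (hausdorff_injective (@continuous_set_val T A) (@set_val_inj T A)).
move=> F PF _.
have FA : F (set_val @^-1` A).
  by apply: (@filterS _ F _ setT) => [x _|]; [exact: set_valP|exact: filterT].
have [p [Ap cl]] := cA (set_val @ F) _ FA.
have Ap' : p \in A by exact: mem_set.
exists (exist _ p Ap'); split => // U V FU [_ [[W oW <-] Wp] WV].
have FU' : F (set_val @^-1` (set_val @` U)).
  by apply: (@filterS _ F _ U) => // x Ux; exists x.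
have nW : nbhs p W by exact: open_nbhs_nbhs.
have [z [[y Uy yz] Wz]] := cl _ _ FU' nW.
exists y; split => //; apply: WV; rewrite /= yz; exact: Wz.
Qed.

(** * The unit interval and suprema over it *)

Section Interval.
Context (R : realType).
Local Notation I := (unit_interval R).

Lemma compact_hausdorff_unit_interval : compact_hausdorff I.
Proof.
apply: compact_hausdorff_set; first exact: Rhausdorff.
rewrite (_ : unit_interval R = `[0, 1]%classic); first exact: segment_compact.
by rewrite set_itvE.
Qed.

Definition clampI_subproof (x : R) : Num.max 0 (Num.min 1 x) \in I.
Proof.
by apply: mem_set; apply/andP; rewrite le_max lexx ge_max ler01 ge_min lexx.
Qed.

Definition clampI (x : R) : I := exist (fun t => t \in I) _ (clampI_subproof x).

Lemma clampI_id (t : I) : clampI (set_val t) = t.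
Proof.
apply: val_inj => /=; have /= /andP[t0 t1] := set_valP t.
by rewrite (min_idPr _)// (max_idPr _).
Qed.

Lemma set_val_clampI x : 0 <= x <= 1 -> set_val (clampI x) = x.
Proof.
move=> /andP[x0 x1]; rewrite set_valE /=.
by rewrite (min_idPr _)// (max_idPr _).
Qed.

Lemma continuous_clampI : continuous clampI.
Proof.
apply: continuous_into_set => x /=.
apply: continuous_max; first exact: cvg_cst.
by apply: continuous_min; [exact: cvg_cst|exact: cvg_id].
Qed.

(** Compactness of the interval makes the continuity of [F] in [k] uniform in [t], and a supremum
    moves no more than its terms do. *)
Lemma continuous_sup_interval (K : topologicalType) (F : K * I -> R) :
  continuous F -> (forall p, 0 <= F p <= 1) ->
  continuous (fun k => sup (range (fun t => F (k, t)))).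
Proof.
move=> cF F01 k0; apply/cvgrPdist_le => e e0.
have [cI hI] := compact_hausdorff_unit_interval.
have /compact_near_coveringP cN := cI.
have near_k : \forall k \near k0, forall t, `|F (k0, t) - F (k, t)| <= e.
  have := cN K (nbhs k0) (fun k t => `|F (k0, t) - F (k, t)| <= e) _.
  move=> H; have {}H : \forall k \near k0, [set: I] `<=`
      (fun t => `|F (k0, t) - F (k, t)| <= e).
    apply: H => t _.
    have e2 : 0 < e / 2 by rewrite divr_gt0.
    have /cvgrPdist_le/(_ _ e2) := cF (k0, t); case=> -[U V] /= [nU nV] UV.
    exists (V, U) => // -[t' k] /= [Vt Uk].
    have /= h1 := UV (k, t') (conj Uk Vt).
    have /= h2 := UV (k0, t') (conj (nbhs_singleton nU) Vt).
    rewrite -(subrKA (F (k0, t))) [e]splitr.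
    apply: le_trans (ler_normD _ _) _; rewrite lerD//.
    by rewrite distrC.
  by apply: filterS H => k H t; exact: H.
have hs k : has_sup (range (fun t => F (k, t))).
  split; first by exists (F (k, I0 R)), (I0 R).
  by exists 1 => _ [t _ <-]; case/andP: (F01 (k, t)).
apply: filterS near_k => k Hk.
have le1 k1 k2 : (forall t, `|F (k1, t) - F (k2, t)| <= e) ->
    sup (range (fun t => F (k1, t))) - sup (range (fun t => F (k2, t))) <= e.
  move=> Hkk; rewrite lerBlDr; apply: ge_sup.
    by exists (F (k1, I0 R)), (I0 R).
  move=> _ [t _ <-].
  have : F (k2, t) <= sup (range (fun t => F (k2, t))).
    by apply: ub_le_sup; [case: (hs k2)|exists t].
  have := Hkk t; rewrite ler_norml => /andP[_]; rewrite lerBlDr => h1 h2.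
  by apply: le_trans h1 _; rewrite lerD2l.
rewrite ler_norml le1// andbT lerNl opprB le1// => t.
by rewrite distrC.
Qed.

End Interval.

(** * An invariant weight vanishing exactly at the basepoint *)

(** A point is the image of the compact Hausdorff space [bool] under a constant map. *)
Lemma weak_hausdorff_closed1 (X : topologicalType) (x : X) :
  weak_hausdorff X -> closed [set x].
Proof.
move=> hX; have -> : [set x] = range (fun _ : bool => x).
  by apply/seteqP; split=> [_ ->|_ [_ _ <-]] //; exists true.
apply: hX; first exact: bool_compact.
  exact: discrete_hausdorff.
exact: cst_continuous.
Qed.

Lemma weak_hausdorff_image (X K : topologicalType) (u : K -> X) (C : set K) :
  weak_hausdorff X -> compact_hausdorff K -> continuous u -> closed C ->
  closed (u @` C).
Proof.
move=> hX [cK hK] cu cC; have -> : u @` C = range (fun k : C => u (set_val k)).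
  apply/seteqP; split=> [_ [k Ck <-]|_ [k _ <-]].
    by exists (exist _ k (mem_set Ck)).
  by exists (set_val k) => //; exact: set_valP.
have [cC' hC'] : compact_hausdorff C.
  by apply: compact_hausdorff_set hK _; exact: (subclosed_compact cC cK).
apply: hX => //; apply: continuous_comp_fun cu; exact: continuous_set_val.
Qed.

(** If the image of [u] misses [(x, t)], then [t] avoids the closed set [B] of second coordinates
    lying over [x]. A neighbourhood [N] of [t] with closure disjoint from [B] exists by regularity,
    and the first coordinates lying over that closure form a closed set missing [x]. *)
Lemma weak_hausdorff_prod (X L : topologicalType) :
  weak_hausdorff X -> compact_hausdorff L -> weak_hausdorff (X * L)%type.
Proof.
move=> hX [cL hL] K u cK hK cu.
have cu1 : continuous (fun k => (u k).1).
  by apply: continuous_comp_fun cu _; exact: continuous_fst.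
have cu2 : continuous (fun k => (u k).2).
  by apply: continuous_comp_fun cu _; exact: continuous_snd.
rewrite -openC openE => -[x t] xt.
pose A := [set k | (u k).1 = x].
have clA : closed A.
  have /continuous_closedP/(_ [set x]) := cu1; apply.
  exact: weak_hausdorff_closed1.
pose B := (fun k => (u k).2) @` A.
have clB : closed B.
  apply: compact_closed => //; apply: continuous_compact.
    exact: continuous_subspaceT.
  exact: (subclosed_compact clA cK).
have nB : nbhs t (~` B).
  apply: open_nbhs_nbhs; split; first by rewrite openC.
  move=> [k Ak tk]; apply: xt; exists k => //.
  by rewrite -Ak -tk -surjective_pairing.
have [N nN NB] := @compact_regular L t setT hL cL filterT _ nB.
have clD : closed ((fun k => (u k).1) @` [set k | closure N (u k).2]).
  apply: weak_hausdorff_image => //.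
  have /continuous_closedP/(_ (closure N)) := cu2; apply.
  exact: closed_closure.
exists (~` ((fun k => (u k).1) @` [set k | closure N (u k).2]), N) => /=.
  split=> //; apply: open_nbhs_nbhs; split; first by rewrite openC.
  by move=> [k Nk xk]; apply: (NB _ Nk); exists k.
move=> [y s] /= [Dy Ns] [k _ ks]; apply: Dy; exists k; rewrite ks //=.
exact: subset_closure.
Qed.

Lemma weak_hausdorff_set (X : topologicalType) (A : set X) :
  weak_hausdorff X -> weak_hausdorff A.
Proof.
move=> hX K u cK hK cu.
have -> : range u = set_val @^-1` range (fun k => set_val (u k)).
  apply/seteqP; split=> [_ [k _ <-]|a [k _ /set_val_inj <-]]; by exists k.
have /continuous_closedP/(_ (range (fun k => set_val (u k)))) :=
  @continuous_set_val X A; apply.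
apply: hX => //; exact: (continuous_comp_fun cu (@continuous_set_val X A)).
Qed.

Lemma weak_hausdorff_kification (X : topologicalType) :
  weak_hausdorff X -> weak_hausdorff (kification X).
Proof.
move=> hX K u cK hK cu.
have : closed (range (u : K -> X)).
  apply: hX => //.
  exact: (continuous_comp_fun cu (@continuous_kification_id X)).
by have /continuous_closedP := @continuous_kification_id X; apply.
Qed.

Section Weight.
Context (R : realType) (G : topGroupType) (X : topologicalType).
Context (a : G -> X -> X) (x0 : X).
Local Notation I := (unit_interval R).

Definition cylinder_set : set (X * I) := [set p | set_val p.2 = 0 \/ p.1 = x0].
(** K-ified to be an admissible target: homotopy extension is assumed for cgwh spaces. *)
Definition cylinder : topologicalType := kification cylinder_set.

Lemma cylinder_cgwh : weak_hausdorff X -> cgwh cylinder.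
Proof.
move=> hX; split; first exact: kification_cg.
have hP := weak_hausdorff_prod hX (compact_hausdorff_unit_interval R).
exact: weak_hausdorff_kification (weak_hausdorff_set hP).
Qed.

Hypothesis a0 : forall g, a g x0 = x0.

Lemma cylinder_act_subproof g (z : cylinder) :
  (a g (set_val (z : cylinder_set)).1, (set_val (z : cylinder_set)).2)
    \in cylinder_set.
Proof.
apply: mem_set => /=; case: (set_valP (z : cylinder_set)) => h; first by left.
by right; rewrite h a0.
Qed.

Definition cylinder_act (g : G) (z : cylinder) : cylinder :=
  exist (fun p => p \in cylinder_set) _ (cylinder_act_subproof g z).

Lemma cylinder_gspace : is_gspace a -> is_gspace cylinder_act.
Proof.
move=> [a1 aM ca]; split.
- move=> z; apply: (@set_val_inj _ cylinder_set); rewrite set_valE /= a1.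
  by rewrite -surjective_pairing.
- move=> g h z; apply: (@set_val_inj _ cylinder_set).
  by rewrite !set_valE /= aM.
apply: continuous_into_kification_cg; first exact: kification_cg.
apply: continuous_into_set.
have cz : continuous (fun p : kprod G cylinder => set_val (p.2 : cylinder_set)).
  exact: (continuous_comp_fun (@continuous_kprod_snd G cylinder)
    (@continuous_kification_val _ cylinder_set)).
apply: continuous_pair; last exact: (continuous_comp_fun cz (@continuous_snd _ _)).
apply: (@continuous_comp_fun _ (kprod G X) _
  (fun p : kprod G cylinder => (p.1, (set_val (p.2 : cylinder_set)).1) : kprod G X)
  (fun p : kprod G X => a p.1 p.2) _ ca).
apply: continuous_into_kification_cg; first exact: kification_cg.
apply: continuous_pair; first exact: continuous_kprod_fst.
exact: (continuous_comp_fun cz (@continuous_fst _ _)).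
Qed.

Lemma cylinder_base_subproof x : (x, I0 R) \in cylinder_set.
Proof. by apply: mem_set; left. Qed.

Lemma cylinder_path_subproof t : (x0, t) \in cylinder_set.
Proof. by apply: mem_set; right. Qed.

(* As in Strom's characterisation of cofibrations, a retraction [h] of the
   cylinder [X * I] onto [X * 0 \cup x0 * I] measures the distance to the
   basepoint by the defect [sup_t |t - pr2 (h (x, t))|]. *)
Lemma nondegenerate_weight :
  cgwh X -> is_gspace a -> nondegenerately_based R a x0 ->
  exists w : X -> R, [/\ forall x, 0 <= w x, forall x, w x = 0 <-> x = x0,
    forall g x, w (a g x) = w x &
    forall (K : topologicalType) (u : K -> X), compact_hausdorff K ->
      continuous u -> continuous (w \o u)].
Proof.
move=> [cgX whX] ga hnd.
pose f (x : X) : cylinder :=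
  exist (fun p => p \in cylinder_set) _ (cylinder_base_subproof x).
pose c (t : I) : cylinder :=
  exist (fun p => p \in cylinder_set) _ (cylinder_path_subproof t).
have cf : continuous f.
  apply: continuous_into_kification_cg => //; apply: continuous_into_set.
  exact: (continuous_pair (@continuous_idfun X) (@cst_continuous X I (I0 R))).
have cc : continuous c.
  apply: continuous_into_kification.
    exact: compact_hausdorff_unit_interval.
  apply: continuous_into_set.
  exact: (continuous_pair (@cst_continuous I X x0) (@continuous_idfun I)).
have fe : equivariant a cylinder_act f.
  by move=> g x; exact: (@set_val_inj _ cylinder_set).
have cfix g t : cylinder_act g (c t) = c t.
  by apply: (@set_val_inj _ cylinder_set); rewrite !set_valE /= a0.
have c0 : c (I0 R) = f x0 by exact: (@set_val_inj _ cylinder_set).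
have [h [ch he hf hc]] := hnd cylinder cylinder_act f c (cylinder_cgwh whX)
  (cylinder_gspace ga) cf fe cc cfix c0.
pose p1 x t := (set_val (h (x, t) : cylinder_set)).1.
pose p2 x t := set_val (set_val (h (x, t) : cylinder_set)).2.
have cval : continuous (fun z : kprod X I => set_val (h z : cylinder_set)).
  exact: (continuous_comp_fun ch (@continuous_kification_val _ cylinder_set)).
have p2_01 x t : 0 <= p2 x t <= 1.
  by have := set_valP (set_val (h (x, t) : cylinder_set)).2.
(* [h] is continuous on the k-product, so it is evaluated along pairs of maps from a compact
   Hausdorff space. *)
have ctest (K : topologicalType) (u : K -> X) (v : K -> I) :
    compact_hausdorff K -> continuous u -> continuous v ->
    continuous (fun k => set_val (h (u k, v k) : cylinder_set)).
  move=> cK cu cv.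
  exact: (continuous_comp_fun (continuous_into_kprod cK cu cv) cval).
have cI := compact_hausdorff_unit_interval R.
pose F x (t : I) := `|set_val t - p2 x t|.
have F01 x t : 0 <= F x t <= 1.
  rewrite /F normr_ge0 /= ler_norml.
  have /= /andP[t0 t1] := set_valP t; have /andP[q0 q1] := p2_01 x t.
  rewrite lerBlDr lerBrDr; apply/andP; split.
    by rewrite (le_trans _ t0)// addrC subr_le0.
  by rewrite (le_trans t1)// lerDl.
have hs x : has_sup (range (F x)).
  split; first by exists (F x (I0 R)), (I0 R).
  by exists 1 => _ [t _ <-]; case/andP: (F01 x t).
exists (fun x => sup (range (F x))); split.
- move=> x; apply: le_trans (ub_le_sup (hs x).2 _); last by exists (I0 R).
  by case/andP: (F01 x (I0 R)).
- move=> x; split=> [w0|->]; last first.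
    rewrite (_ : range _ = [set 0]) ?sup1//.
    apply/seteqP; split=> [_ [t _ <-]|_ ->]; last first.
      by exists (I0 R) => //; rewrite /F /p2 hc /= subrr normr0.
    by rewrite /F /p2 hc /= subrr normr0.
  (* Zero defect puts [h (x, t)] at height [t], hence over the basepoint when [t > 0]. As the
     basepoint is closed, this persists at [t = 0], where [h (x, t)] is [(x, 0)]. *)
  have p2E t : p2 x t = set_val t.
    have : F x t <= 0 by rewrite -w0; apply: (ub_le_sup (hs x).2); exists t.
    by rewrite normr_le0 subr_eq0 => /eqP.
  have p1E t : set_val t != 0 -> p1 x t = x0.
    move=> t0; case: (set_valP (h (x, t) : cylinder_set)) => //.
    by rewrite -/(p2 x t) p2E => /eqP; rewrite (negbTE t0).
  have cp1 : continuous (fun s : R => p1 x (clampI s)).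
    have : continuous (fun t => p1 x t).
      exact: (continuous_comp_fun (ctest I (fun=> x) id cI
        (@cst_continuous _ _ _) (@continuous_idfun _)) (@continuous_fst _ _)).
    by move=> cp; exact: (continuous_comp_fun (@continuous_clampI R) cp).
  have cl0 : closed [set s : R | p1 x (clampI s) = x0].
    have /continuous_closedP/(_ [set x0]) := cp1; apply.
    exact: weak_hausdorff_closed1.
  have : p1 x (clampI (0 : R)) = x0.
    apply: cl0; rewrite closureEnbhs => A B AS nB.
    have nB' : \forall s \near (0 : R)^'+, B s by exact: cvg_within nB.
    have [s [Bs s0]] : exists s, B s /\ 0 < s.
      have /filter_ex[s [Bs s0]] : \forall s \near (0 : R)^'+, B s /\ 0 < s.
        by near=> s; split; near: s => //; exact: nbhs_right_gt.
      by exists s.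
    exists s; split => //; apply: AS; apply: p1E.
    by rewrite set_valE /= gt_eqF// lt_max lt_min ltr01 s0 orbT.
  have -> : clampI (0 : R) = I0 R by exact: (clampI_id (I0 R)).
  by rewrite /p1 hf.
- move=> g x; have -> // : F (a g x) = F x.
  by apply/funext => t; rewrite /F /p2 he.
move=> K u cK cu.
apply: (@continuous_sup_interval R K (fun p => F (u p.1) p.2)) => //.
have cF := ctest (K * I)%type (fun p => u p.1) (fun p => p.2)
  (compact_hausdorff_prod cK cI) (continuous_comp_fun (@continuous_fst _ _) cu)
  (@continuous_snd _ _).
have c1 := continuous_comp_fun (@continuous_snd K I) (@continuous_set_val R _).
have c2 := continuous_comp_fun (continuous_comp_fun cF (@continuous_snd _ _))
  (@continuous_set_val _ _).
by move=> z; apply: cvg_norm; apply: cvgB; [exact: c1|exact: c2].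
Unshelve. all: by end_near. Qed.
End Weight.

(** * Simplices and words *)

Lemma continuous_sum (R : realType) (T : topologicalType) (J : Type) (r : seq J)
    (P : pred J) (F : J -> T -> R) :
  (forall j, continuous (F j)) ->
  continuous (fun x => \sum_(j <- r | P j) F j x).
Proof.
move=> cF; elim: r => [|j r IHr].
  under [X in continuous X]funext do rewrite big_nil; exact: cst_continuous.
under [X in continuous X]funext do rewrite big_cons.
case: (P j) => // x; apply: cvgD; [exact: cF|exact: IHr].
Qed.

Section Simplices.
Context (R : realType).
Local Notation I := (unit_interval R).
Local Notation Delta := (simplex R).

Lemma simplex_ext n (u v : Delta n) :
  (forall i, set_val u i = set_val v i) -> u = v.
Proof. by move=> uv; apply: set_val_inj; apply/funext. Qed.

Lemma simplex_ge0 n (u : Delta n) i : 0 <= set_val u i.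
Proof. by have [u0 _] := set_valP u; exact: u0. Qed.

Lemma simplex_sum1 n (u : Delta n) : \sum_i set_val u i = 1.
Proof. by have [_ u1] := set_valP u; exact: u1. Qed.

Lemma unit_interval_ge0 (t : I) : 0 <= set_val t.
Proof. by have /andP[] := set_valP t. Qed.

Lemma unit_interval_le1 (t : I) : set_val t <= 1.
Proof. by have /andP[] := set_valP t. Qed.

(** Value at [u] of the affine function that takes the value [f i] at vertex [i]. Indexing [f] by
    naturals lets one sequence serve simplices of all dimensions. *)
Definition pairing n (u : Delta n) (f : nat -> R) : R :=
  \sum_(i < n.+1) set_val u i * f i.

Lemma simplex_mapE q p (phi : 'I_q.+1 -> 'I_p.+1) (v : Delta q) i :
  set_val (simplex_map phi v) i = \sum_(j | phi j == i) set_val v j.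
Proof. by []. Qed.

Lemma pairing_simplex_map q p (phi : 'I_q.+1 -> 'I_p.+1) (v : Delta q)
    (f g : nat -> R) :
  (forall j : 'I_q.+1, f (phi j) = g j) ->
  pairing (simplex_map phi v) f = pairing v g.
Proof.
move=> fg; rewrite /pairing [RHS](partition_big phi xpredT)//=.
apply: eq_bigr => i _; rewrite simplex_mapE mulr_suml.
by apply: eq_bigr => j /eqP <-; rewrite fg.
Qed.

Lemma pairing_addc n (u : Delta n) c f :
  pairing u (fun i => c + f i) = c + pairing u f.
Proof.
rewrite /pairing -[c in RHS]mul1r -(simplex_sum1 u).
by rewrite mulr_suml -big_split /=; apply: eq_bigr => i _; rewrite mulrDr.
Qed.

Lemma simplex_map_comp r q p (psi : 'I_r.+1 -> 'I_q.+1)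
    (phi : 'I_q.+1 -> 'I_p.+1) (v : Delta r) :
  simplex_map phi (simplex_map psi v) = simplex_map (phi \o psi) v.
Proof.
apply: simplex_ext => i; rewrite !simplex_mapE.
rewrite [RHS](partition_big psi (fun j => phi j == i))//=.
apply: eq_bigr => j /eqP ji; rewrite simplex_mapE; apply: eq_bigl => k.
by case: eqP => [->|]; rewrite ?ji ?eqxx ?andbF.
Qed.

Lemma convex_subproof n (t : I) (u v : Delta n) :
  ((fun i => (1 - set_val t) * set_val u i + set_val t * set_val v i)
    : {ptws 'I_n.+1 -> R}) \in simplex R n.
Proof.
apply: mem_set; split.
  move=> i; apply: addr_ge0; apply: mulr_ge0; try exact: simplex_ge0.
    by rewrite subr_ge0 unit_interval_le1.
  exact: unit_interval_ge0.
by rewrite big_split /= -!mulr_sumr !simplex_sum1 !mulr1 subrK.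
Qed.

Definition convex n (t : I) (u v : Delta n) : Delta n :=
  exist (fun u => u \in simplex R n) _ (convex_subproof t u v).

Lemma convexE n (t : I) (u v : Delta n) i : set_val (convex t u v) i =
  (1 - set_val t) * set_val u i + set_val t * set_val v i.
Proof. by []. Qed.

Lemma simplex_map_convex q p (phi : 'I_q.+1 -> 'I_p.+1) t (u v : Delta q) :
  simplex_map phi (convex t u v) =
  convex t (simplex_map phi u) (simplex_map phi v).
Proof.
apply: simplex_ext => i; rewrite convexE !simplex_mapE !mulr_sumr -big_split /=.
by apply: eq_bigr.
Qed.

Lemma convex0 n (u v : Delta n) : convex (I0 R) u v = u.
Proof.
by apply: simplex_ext => i; rewrite convexE /= subr0 mul1r mul0r addr0.
Qed.

Lemma convex1 n (u v : Delta n) : convex (I1 R) u v = v.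
Proof.
by apply: simplex_ext => i; rewrite convexE /= subrr mul1r mul0r add0r.
Qed.

Lemma convex_id n t (u : Delta n) : convex t u u = u.
Proof.
by apply: simplex_ext => i; rewrite convexE -mulrDl subrK mul1r.
Qed.

Lemma vertex_subproof n (j : 'I_n.+1) :
  ((fun i => (i == j)%:R) : {ptws 'I_n.+1 -> R}) \in simplex R n.
Proof.
apply: mem_set; split; first by move=> i; exact: ler0n.
by rewrite (bigD1 j)//= eqxx big1 ?addr0// => i /negbTE ->.
Qed.

Definition vertex n (j : 'I_n.+1) : Delta n :=
  exist (fun u => u \in simplex R n) _ (vertex_subproof j).

Lemma vertexE n (j i : 'I_n.+1) : set_val (vertex j) i = (i == j)%:R.
Proof. by []. Qed.

Lemma edgeE (t : I) i :
  set_val (edge t) i = if i == ord0 then 1 - set_val t else set_val t.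
Proof. by []. Qed.

Lemma simplex_map_cst q p (phi : 'I_q.+1 -> 'I_p.+1) j (v : Delta q) :
  (forall i, phi i = j) -> simplex_map phi v = vertex j.
Proof.
move=> phij; apply: simplex_ext => i; rewrite simplex_mapE vertexE.
have [->|/negbTE ij] := eqVneq i j.
  by rewrite -[RHS](simplex_sum1 v); apply: eq_bigl => k; rewrite phij eqxx.
by rewrite big_pred0// => k; rewrite phij eq_sym ij.
Qed.

Lemma pairing_vertex n (j : 'I_n.+1) f : pairing (vertex j) f = f j.
Proof.
rewrite -(@simplex_map_cst 0 n (fun=> j) j (vertex ord0))//.
rewrite (@pairing_simplex_map _ _ _ _ _ (fun=> f j))//.
by rewrite /pairing big_ord1 vertexE eqxx mul1r.
Qed.

Lemma simplex_map_vertex q p (phi : 'I_q.+1 -> 'I_p.+1) j :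
  simplex_map phi (vertex j) = vertex (phi j).
Proof.
rewrite -(@simplex_map_cst 0 q (fun=> j) j (vertex ord0))// simplex_map_comp.
exact: simplex_map_cst.
Qed.

(** Meant for [i < n]: beyond that, [inord] falls back to vertex 0. *)
Definition consecutive n (i : nat) (k : 'I_2) : 'I_n.+1 := inord (i + k).

Definition spine_edge n (i : nat) (t : I) : Delta n :=
  simplex_map (@consecutive n i) (edge t).

Lemma pairing_spine_edge n i t f : (i < n)%N ->
  pairing (spine_edge n i t) f = f i + set_val t * (f i.+1 - f i).
Proof.
move=> ltin; rewrite (@pairing_simplex_map _ _ _ _ _ (fun k => f (i + k)%N)).
  rewrite /pairing !big_ord_recl big_ord0 !edgeE /= addn0 addn1; ring.
by move=> j; rewrite inordK//; case: j => -[|[|]]//= _; lia.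
Qed.

Lemma spine_edge0 n i t : set_val t = 0 -> (i < n)%N ->
  spine_edge n i t = vertex (inord i).
Proof.
move=> t0 ltin.
rewrite /spine_edge; have -> : edge t = vertex ord0.
  apply: simplex_ext => k; rewrite edgeE vertexE t0 subr0.
  by case: ifP.
by rewrite simplex_map_vertex /consecutive addn0.
Qed.

Lemma spine_edge1 n i t : set_val t = 1 -> (i < n)%N ->
  spine_edge n i t = vertex (inord i.+1).
Proof.
move=> t1 ltin.
rewrite /spine_edge; have -> : edge t = vertex ord_max.
  apply: simplex_ext => k; rewrite edgeE vertexE t1 subrr.
  by case: k => -[|[|]].
by rewrite simplex_map_vertex /consecutive /= addn1.
Qed.

(** Effect on the spine of the degeneracy that deletes a basepoint letter. *)
Lemma simplex_map_spine_edge_cst q p (phi : 'I_q.+1 -> 'I_p.+1) i t :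
  (i < q)%N -> phi (inord i.+1) = phi (inord i) ->
  simplex_map phi (spine_edge q i t) = vertex (phi (inord i)).
Proof.
move=> ltiq phii; rewrite simplex_map_comp; apply: simplex_map_cst => -[k k2].
rewrite /= /consecutive /=; case: k k2 => [|[|]]//= _; first by rewrite addn0.
by rewrite addn1.
Qed.

Lemma simplex_map_spine_edge q p (phi : 'I_q.+1 -> 'I_p.+1) i j t :
  (i < q)%N -> phi (inord i) = j :> nat -> phi (inord i.+1) = j.+1 :> nat ->
  simplex_map phi (spine_edge q i t) = spine_edge p j t.
Proof.
move=> ltiq ij ij1; rewrite simplex_map_comp; congr simplex_map.
apply/funext => -[k k2]; apply: val_inj => /=; rewrite /consecutive /=.
have := ltn_ord (phi (inord i.+1)); rewrite ij1 => lejp.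
case: k k2 => [|[|]]//= _.
  by rewrite !addn0 ij inordK//; lia.
by rewrite !addn1 ij1 inordK.
Qed.

Lemma simplex_map_continuous q p (phi : 'I_q.+1 -> 'I_p.+1) :
  continuous (@simplex_map R q p phi).
Proof.
apply: continuous_into_set; apply: continuous_into_ptws => i.
rewrite (_ : (fun _ => _) =
  fun v : Delta q => \sum_(j | phi j == i) set_val v j)//.
apply: continuous_sum => j.
exact: (continuous_comp_fun (@continuous_set_val _ _)
  (@continuous_ptws_eval _ _ j)).
Qed.

End Simplices.

(** * Interval products in the nerve *)

Section NerveProducts.
Context (M : preTopologicalMonoidType).

(** Indexing the entries by naturals turns the filtered product over ['I_p] into an interval
    product, which can be split and telescoped. *)
Lemma nerve_mapE q p (phi : 'I_q.+1 -> 'I_p.+1) (f : nat -> M) j :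
  nerve_map phi ((fun i : 'I_p => f i) : kpow M p) j =
  (\prod_(phi (widen_ord (leqnSn q) j) <= k < phi (lift ord0 j)) f k)%g.
Proof.
rewrite /nerve_map.
rewrite -(big_mkord (fun k => (phi (widen_ord (leqnSn q) j) <= k <
  phi (lift ord0 j))%N) f).
set lo := nat_of_ord (phi _); set hi := nat_of_ord (phi _).
have hip : (hi <= p)%N by rewrite -ltnS ltn_ord.
rewrite [RHS](big_nat_widen _ _ _ _ _ hip).
rewrite [RHS](big_nat_widenl _ _ _ _ _ (leq0n lo)).
by apply: eq_bigl => k; rewrite andbC.
Qed.

Lemma prod_recr (f : nat -> M) j :
  (\prod_(0 <= k < j.+1) f k)%g = (\prod_(0 <= k < j) f k * f j)%g.
Proof. exact: big_nat_recr. Qed.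

Lemma prod_cat (f : nat -> M) a b c : (a <= b)%N -> (b <= c)%N ->
  (\prod_(a <= k < c) f k)%g =
  (\prod_(a <= k < b) f k * \prod_(b <= k < c) f k)%g.
Proof. exact: big_cat_nat. Qed.

Lemma prod_ltn (f : nat -> M) a b : (a < b)%N ->
  (\prod_(a <= k < b) f k)%g = (f a * \prod_(a.+1 <= k < b) f k)%g.
Proof. exact: big_ltn. Qed.

Definition extend p (m : 'I_p -> M) (k : nat) : M :=
  if insub k is Some i then m i else 1%g.

Lemma extendE p (m : 'I_p -> M) (i : 'I_p) : extend m i = m i.
Proof. by rewrite /extend valK. Qed.

Lemma extendK p (m : 'I_p -> M) : (fun i : 'I_p => extend m i) = m.
Proof. by apply/funext => i; rewrite extendE. Qed.

(** Functoriality of the nerve, in product form. The inequality [g a <= g b] is carried along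
    because the inductive step needs it to split an interval product. *)
Lemma prod_telescope (f : nat -> M) (g : nat -> nat) a b :
  (a <= b)%N -> (forall k, (a <= k < b)%N -> (g k <= g k.+1)%N) ->
  (\prod_(a <= k < b) \prod_(g k <= l < g k.+1) f l)%g =
  (\prod_(g a <= l < g b) f l)%g /\ (g a <= g b)%N.
Proof.
elim: b => [|b IHb] leab gS.
  by move: leab; rewrite leqn0 => /eqP ->; rewrite !big_geq.
move: leab; rewrite leq_eqVlt => /predU1P[->|]; first by rewrite !big_geq.
rewrite ltnS => leab; have [] := IHb leab.
  by move=> k /andP[ak kb]; apply: gS; rewrite ak ltnW.
move=> prodE gab; have gb : (g b <= g b.+1)%N by apply: gS; rewrite leab ltnSn.
split; last exact: leq_trans gb.
by rewrite big_nat_recr//= prodE (big_cat_nat gab gb).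
Qed.

End NerveProducts.

Section Words.
Context (X : topologicalType) (x0 : X).
Local Notation J := (james x0).
Local Notation eta := (james_unit x0).

(** A concatenation of reduced words is reduced: this is the freeness of [J]. *)
Lemma jlettersM (v w : J) : jletters (v * w)%g = jletters v ++ jletters w.
Proof.
rewrite [LHS]jwordK filter_cat.
by rewrite -!(jwordK x0) !jlettersK.
Qed.

Lemma jletters_eta x : jletters (eta x) = if x == x0 then [::] else [:: x].
Proof. by rewrite /james_unit jwordK /=; case: eqP. Qed.

Lemma prod_eta (x : nat -> X) r :
  (\prod_(k <- r) eta (x k))%g = jword x0 [seq x k | k <- r].
Proof.
elim: r => [|k r IHr]; first by rewrite big_nil.
by rewrite big_cons IHr -[RHS]/(jword x0 ([:: x k] ++ _)) jword_cat.
Qed.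

Lemma jletters_prod_eta (x : nat -> X) n a b :
  (forall k, (k < n)%N -> x k != x0) -> (b <= n)%N ->
  jletters (\prod_(a <= k < b) eta (x k))%g = [seq x k | k <- index_iota a b].
Proof.
move=> xn bn; rewrite prod_eta jwordK; apply/all_filterP/allP => y.
move=> /mapP[k]; rewrite mem_index_iota => /andP[_ kb] ->.
exact/xn/(leq_trans kb).
Qed.

Lemma prod_slice (A B C : seq X) :
  (\prod_(size A <= k < size A + size B) eta (nth x0 (A ++ B ++ C) k))%g =
  jword x0 B.
Proof.
rewrite prod_eta /index_iota addKn map_nth_iota; last by rewrite !size_cat; lia.
by rewrite drop_size_cat// take_size_cat.
Qed.

(** * Factoring a nerve simplex through its letters *)

Section Canonical.
Context (f : nat -> J) (p : nat) (s : seq X).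
Hypothesis Hs : jletters (\prod_(0 <= k < p) f k)%g = s.

Definition letters_before j := size (jletters (\prod_(0 <= k < j) f k)%g).

Lemma letters_beforeS j :
  letters_before j.+1 = (letters_before j + size (jletters (f j)))%N.
Proof. by rewrite /letters_before prod_recr jlettersM size_cat. Qed.

Lemma letters_before0 : letters_before 0 = 0%N.
Proof. by rewrite /letters_before big_geq. Qed.

Lemma letters_before_max : letters_before p = size s.
Proof. by rewrite /letters_before Hs. Qed.

Lemma letters_before_homo : {homo letters_before : i j / (i <= j)%N}.
Proof.
move=> i j; elim: j => [|j IHj]; first by rewrite leqn0 => /eqP ->.
rewrite leq_eqVlt => /predU1P[->//|/IHj h]; apply: leq_trans h _.
by rewrite letters_beforeS leq_addr.
Qed.

Lemma letters_before_le j : (j <= p)%N -> (letters_before j <= size s)%N.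
Proof. by rewrite -letters_before_max; exact: letters_before_homo. Qed.

Lemma prod_letters_between j : (j < p)%N ->
  (\prod_(letters_before j <= k < letters_before j.+1) eta (nth x0 s k))%g = f j.
Proof.
move=> ltjp.
have -> : s = jletters (\prod_(0 <= k < j) f k)%g ++ jletters (f j) ++
              jletters (\prod_(j.+1 <= k < p) f k)%g.
  by rewrite -!jlettersM -prod_ltn// -prod_cat// ltnW.
by rewrite letters_beforeS prod_slice jlettersK.
Qed.

(** Cuts the word [s] after each factor. Through this map, which preserves the first and last
    vertices, any nerve simplex comes from the simplex whose entries are the letters of its total
    product. *)
Definition canonical_map (j : 'I_p.+1) : 'I_(size s).+1 :=
  inord (letters_before j).

Lemma canonical_mapE j : canonical_map j = letters_before j :> nat.
Proof. by rewrite inordK// ltnS letters_before_le// -ltnS. Qed.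

Lemma canonical_map_monotone : Defs.monotone canonical_map.
Proof. by move=> i j ij; rewrite !canonical_mapE letters_before_homo. Qed.

Lemma canonical_map_nerve :
  nerve_map canonical_map ((fun i : 'I_(size s) => eta (nth x0 s i)) : kpow J _) =
  (fun i : 'I_p => f i).
Proof.
apply/funext => j.
rewrite (nerve_mapE canonical_map (fun k => eta (nth x0 s k))) !canonical_mapE /=.
by rewrite /bump /= add1n prod_letters_between.
Qed.

End Canonical.

Lemma nth_jletters_neq (m : J) k : (k < size (jletters m))%N ->
  nth x0 (jletters m) k != x0.
Proof.
move=> km; apply: contraTneq (mem_nth x0 km) => ->.
by case: m {km} => s /= x0s.
Qed.

End Words.

(** * The deformation onto the spine *)

Section Deformation.
Context (R : realType) (X : topologicalType) (x0 : X) (w : X -> R).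
Hypothesis w_ge0 : forall x, 0 <= w x.
Hypothesis w_eq0 : forall x, w x = 0 <-> x = x0.
Local Notation I := (unit_interval R).
Local Notation J := (james x0).
Local Notation eta := (james_unit x0).
Local Notation B := (classifying R J).
Local Notation Delta := (simplex R).
Local Notation SX := (susp R x0).

(** Only the first [n] letters of the sequence [x] count, and some may be the basepoint. *)
Definition word_cell n (x : nat -> X) (u : Delta n) : {p & cell R J p} :=
  mkcell ((fun i : 'I_n => eta (x i)) : kpow J n) u.

Definition chart n (x : nat -> X) (u : Delta n) : B :=
  classifying_pi (word_cell x u).

Lemma chart_map q p (phi : 'I_q.+1 -> 'I_p.+1) (x' x : nat -> X) (v : Delta q) :
  Defs.monotone phi ->
  (forall j, (j < q)%N ->
    (\prod_(phi (inord j) <= k < phi (inord j.+1)) eta (x k))%g = eta (x' j)) ->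
  chart x' v = chart x (simplex_map phi v).
Proof.
move=> mphi xphi; rewrite /chart /word_cell -classifying_glue//.
congr (classifying_pi (mkcell _ v)); apply/funext => j.
rewrite (nerve_mapE phi (fun k => eta (x k))) -xphi//.
congr (\big[_/_]_(nat_of_ord (phi _) <= _ < phi _) _); apply: val_inj.
  by rewrite /= inordK// ltnS ltnW.
by rewrite /= inordK ?lift0// ltnS.
Qed.

Definition susp_base : SX := susp_pi x0 (x0, I0 R).

Lemma susp_collapsed x t : collapsed x0 (x, t) -> susp_pi x0 (x, t) = susp_base.
Proof.
by move=> c; apply/susp_piP; rewrite /susp_rel_def c /collapsed /= eqxx orbT.
Qed.

(** [q] is the point of the suspension represented by the spine point [e]. Vertices form a separate
    case because the 0-simplex has no edge. *)
Definition spine n (x : nat -> X) (e : Delta n) (q : SX) :=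
  (exists i t, [/\ (i < n)%N, e = spine_edge n i t & q = susp_pi x0 (x i, t)]) \/
  (exists j, e = vertex R j /\ q = susp_base).

Definition total_weight (x : nat -> X) (j : nat) : R := \sum_(0 <= k < j) w (x k).

Lemma total_weightS x j : total_weight x j.+1 = total_weight x j + w (x j).
Proof. by rewrite /total_weight big_nat_recr. Qed.

Lemma total_weight0 x : total_weight x 0 = 0.
Proof. by rewrite /total_weight big_geq. Qed.

(* A pair [(q, h)] consists of the end point in the suspension and of the track
   in [B] of the straight-line homotopy from [u] to the spine. *)
Definition deforms n (x : nat -> X) (u : Delta n) (v : SX * (I -> B)) :=
  exists e, [/\ spine x e v.1,
    pairing e (total_weight x) = pairing u (total_weight x) &
    v.2 = fun t => chart x (convex t u e)].

Lemma total_weight_homo x : {homo total_weight x : i j / (i <= j)%N >-> (i <= j)%R}.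
Proof.
move=> i j; elim: j => [|j IHj]; first by rewrite leqn0 => /eqP ->.
rewrite leq_eqVlt => /predU1P[->//|/IHj h]; apply: le_trans h _.
by rewrite total_weightS lerDl.
Qed.

Lemma deforms_exists n x (u : Delta n) : exists v, deforms x u v.
Proof.
suff : exists (e : Delta n) (q : SX), spine x e q /\
    pairing e (total_weight x) = pairing u (total_weight x).
  by move=> [e [q [eq pe]]]; exists (q, fun t => chart x (convex t u e)), e.
set P := pairing u _.
have P0 : 0 <= P.
  rewrite /P /pairing; apply: sumr_ge0 => i _; rewrite mulr_ge0 ?simplex_ge0//.
  by rewrite -(total_weight0 x) total_weight_homo.
have Pn : P <= total_weight x n.
  rewrite -[leRHS]mul1r -(simplex_sum1 u) mulr_suml; apply: ler_sum => i _.
  by rewrite ler_wpM2l ?simplex_ge0// total_weight_homo// -ltnS.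
have [PT|PT] := leP (total_weight x n) P.
  exists (vertex R ord_max), susp_base; split; first by right; exists ord_max.
  by rewrite pairing_vertex /=; apply/eqP; rewrite eq_le PT Pn.
have ex : exists j, P < total_weight x j by exists n.
(* [P] lies in the half-open interval from the partial sum at [i] to the one at [i.+1], so letter
   [i] has positive weight and can be divided by. *)
case: (ex_minnP ex) => -[|i] Pi imin.
  by move: Pi; rewrite total_weight0 ltNge P0.
have ltin : (i < n)%N by exact: imin.
have leiP : total_weight x i <= P.
  by rewrite leNgt; apply/negP => /imin; rewrite ltnn.
move: Pi; rewrite total_weightS => Pi.
have wi : 0 < w (x i).
  by rewrite -(ltrD2l (total_weight x i)) addr0 (le_lt_trans leiP).
(* The solution of [total_weight x i + t * w (x i) = P]. *)
pose t := clampI ((P - total_weight x i) / w (x i)).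
have tE : set_val t = (P - total_weight x i) / w (x i).
  rewrite set_val_clampI// divr_ge0 ?subr_ge0//=.
  by rewrite ler_pdivrMr// mul1r lerBlDl ltW.
exists (spine_edge n i t), (susp_pi x0 (x i, t)).
split; first by left; exists i, t.
rewrite pairing_spine_edge// total_weightS tE.
rewrite [X in _ * X](_ : _ = w (x i)); last by ring.
by rewrite divfK ?gt_eqF//; ring.
Qed.

(** * Naturality of the tracks along vertex maps into reduced words *)

Section DeformsMap.
Context (n' n : nat) (x' x : nat -> X) (sigma : 'I_n'.+1 -> 'I_n.+1).
Hypothesis x_neq : forall k, (k < n)%N -> x k != x0.
Hypothesis sigma_mono : Defs.monotone sigma.
Hypothesis sigma_word : forall j, (j < n')%N ->
  (\prod_(sigma (inord j) <= k < sigma (inord j.+1)) eta (x k))%g = eta (x' j).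

(** Since [x] has no basepoint letter, comparing letters on both sides shows that [sigma] advances
    by 0 when [x' j] is the basepoint and by 1 otherwise: it is a degeneracy followed by outer
    faces. *)
Let sigma_letters j : (j < n')%N ->
  [seq x k | k <- index_iota (sigma (inord j)) (sigma (inord j.+1))] =
  jletters (eta (x' j)).
Proof.
move=> jn; rewrite -(sigma_word jn) (jletters_prod_eta _ x_neq)//.
by rewrite -ltnS ltn_ord.
Qed.

Let sigma_le j : (j < n')%N -> (sigma (inord j) <= sigma (inord j.+1))%N.
Proof. by move=> jn; apply: sigma_mono; rewrite !inordK; lia. Qed.

Let sigma_cst j : (j < n')%N -> x' j = x0 -> sigma (inord j.+1) = sigma (inord j).
Proof.
move=> jn xj; have := congr1 size (sigma_letters jn).
rewrite size_map size_iota jletters_eta xj eqxx /= => s0.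
apply: val_inj => /=; have := sigma_le jn; lia.
Qed.

Let sigma_step j : (j < n')%N -> x' j != x0 ->
  sigma (inord j.+1) = (sigma (inord j)).+1 :> nat /\ x (sigma (inord j)) = x' j.
Proof.
move=> jn /negbTE xj; have := sigma_letters jn; have := sigma_le jn.
rewrite jletters_eta xj /index_iota.
case E : (sigma (inord j.+1) - sigma (inord j))%N => [|[|k]]//= le [->].
by split=> //; lia.
Qed.

Lemma spine_map e q : spine x' e q -> spine x (simplex_map sigma e) q.
Proof.
case=> [[i [t [iin -> ->]]]|[j [-> ->]]]; last first.
  by right; exists (sigma j); rewrite simplex_map_vertex.
have [xi|xi] := eqVneq (x' i) x0.
  right; exists (sigma (inord i)).
  rewrite (simplex_map_spine_edge_cst _ iin (sigma_cst iin xi)); split=> //.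
  by apply: susp_collapsed; rewrite /collapsed /= xi eqxx.
have [si sx] := sigma_step iin xi.
left; exists (sigma (inord i)), t; split.
- by rewrite -si -ltnS ltn_ord.
- exact: simplex_map_spine_edge.
- by rewrite sx.
Qed.

(** The constant [total_weight x (sigma ord0)] is the weight of the letters cut off by an initial
    outer face. A constant does not change which spine points have the same image as a given
    point. *)
Lemma total_weight_map (j : 'I_n'.+1) :
  total_weight x (sigma j) = total_weight x (sigma ord0) + total_weight x' j.
Proof.
rewrite -(inord_val j) inordK; last exact: ltn_ord.
elim: (nat_of_ord j) (ltn_ord j) => {j} [|j IHj] jn.
  rewrite total_weight0 addr0; congr (total_weight x (sigma _)).
  by apply: val_inj; rewrite /= inordK.
rewrite total_weightS addrA -IHj 1?ltnW//.
have jn' : (j < n')%N by [].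
have [xj|xj] := eqVneq (x' j) x0.
  by rewrite (sigma_cst jn' xj) (iffRL (w_eq0 _) xj) addr0.
by have [-> <-] := sigma_step jn' xj; rewrite total_weightS.
Qed.

(** [simplex_map sigma] is affine, so it carries the segment from [u] to [e] onto the segment
    between their images. *)
Lemma deforms_map u v : deforms x' u v -> deforms x (simplex_map sigma u) v.
Proof.
move=> [e [se pe hE]]; exists (simplex_map sigma e); split.
- exact: spine_map.
- pose g k := total_weight x (sigma ord0) + total_weight x' k.
  rewrite !(@pairing_simplex_map _ _ _ _ _ _ g total_weight_map).
  by rewrite !pairing_addc pe.
rewrite hE; apply/funext => t; rewrite -simplex_map_convex.
exact: chart_map.
Qed.

End DeformsMap.

(** Normal form for the uniqueness proof: ends of edges are counted as vertices, so that an edge is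
    only met in its interior. *)
Lemma spine_normal n (x : nat -> X) e q : spine x e q ->
  (exists j : 'I_n.+1, e = vertex R j /\ q = susp_base) \/
  (exists i t, [/\ (i < n)%N, 0 < set_val t < 1, e = spine_edge n i t &
    q = susp_pi x0 (x i, t)]).
Proof.
case=> [[i [t [iin -> ->]]]|]; last by left.
have [t0|t0] := eqVneq (set_val t) 0.
  left; exists (inord i); rewrite spine_edge0//; split=> //.
  by apply: susp_collapsed; rewrite /collapsed /= t0 eqxx orbT.
have [t1|t1] := eqVneq (set_val t) 1.
  left; exists (inord i.+1); rewrite spine_edge1//; split=> //.
  by apply: susp_collapsed; rewrite /collapsed /= t1 eqxx !orbT.
right; exists i, t; split=> //.
by rewrite lt_neqAle eq_sym t0 unit_interval_ge0 lt_neqAle t1 unit_interval_le1.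
Qed.

Lemma total_weight_lt n x i j : (forall k, (k < n)%N -> x k != x0) ->
  (i < j)%N -> (j <= n)%N -> total_weight x i < total_weight x j.
Proof.
move=> xn ij jn; apply: (@lt_le_trans _ _ (total_weight x i.+1)).
  rewrite total_weightS ltrDl lt_neqAle w_ge0 andbT eq_sym.
  by apply/eqP => /w_eq0/eqP; apply/negP/xn/(leq_trans ij).
exact: total_weight_homo.
Qed.

(** Vertices take the partial sums as values and interiors of edges lie strictly between consecutive
    ones, so the value determines the vertex or the edge, and then the coordinate [t]. *)
Lemma spine_unique n x (e1 e2 : Delta n) q1 q2 :
  (forall k, (k < n)%N -> x k != x0) -> spine x e1 q1 -> spine x e2 q2 ->
  pairing e1 (total_weight x) = pairing e2 (total_weight x) ->
  e1 = e2 /\ q1 = q2.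
Proof.
move=> xn; have Tlt i j := @total_weight_lt n x i j xn.
have Tle i j : (i <= j)%N -> total_weight x i <= total_weight x j.
  exact: total_weight_homo.
have between i t : (i < n)%N -> 0 < set_val t < 1 ->
    total_weight x i < pairing (spine_edge n i t) (total_weight x) <
    total_weight x i.+1.
  move=> iin /andP[t0 t1]; have := Tlt i i.+1 (leqnn _) iin.
  rewrite pairing_spine_edge//; set a := total_weight x i.
  set b := total_weight x i.+1 => ab; have ba : 0 < b - a by rewrite subr_gt0.
  rewrite ltrDl mulr_gt0//= -ltrBrDl.
  by rewrite -[ltRHS]mul1r ltr_pM2r.
have sep (j : 'I_n.+1) i t : (i < n)%N -> 0 < set_val t < 1 ->
    pairing (vertex R j) (total_weight x) <>
    pairing (spine_edge n i t) (total_weight x).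
  move=> iin t01; have /andP[lo hi] := between i t iin t01.
  rewrite pairing_vertex => E; move: lo hi; rewrite -E.
  have [ji|ij] := leqP j i; first by rewrite ltNge Tle.
  by move=> _; rewrite ltNge Tle.
move=> /spine_normal[[j1 [-> ->]]|[i1 [t1 [i1n t1P -> ->]]]]
       /spine_normal[[j2 [-> ->]]|[i2 [t2 [i2n t2P -> ->]]]].
- rewrite !pairing_vertex => E; split=> //; congr vertex; apply: val_inj => /=.
  have [jj|jj|//] := ltngtP j1 j2.
    by have := Tlt _ _ jj (ltn_ord j2); rewrite E ltxx.
  by have := Tlt _ _ jj (ltn_ord j1); rewrite E ltxx.
- by move/sep => /(_ i2n t2P).
- by move/esym/sep => /(_ i1n t1P).
move=> E; have /andP[lo1 hi1] := between i1 t1 i1n t1P.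
have /andP[lo2 hi2] := between i2 t2 i2n t2P.
have ii : i1 = i2.
  have [jj|jj|//] := ltngtP i1 i2.
    have := Tle _ _ jj; rewrite leNgt (lt_trans lo2)// -E.
    by rewrite hi1.
  have := Tle _ _ jj; rewrite leNgt (lt_trans lo1)// E.
  by rewrite hi2.
subst i2; have tt : t1 = t2.
  apply: set_val_inj; move: E; rewrite !pairing_spine_edge//.
  move=> /addrI/(mulIf _); apply.
  by rewrite subr_eq0 gt_eqF// Tlt.
by rewrite tt.
Qed.

Lemma deforms_unique n x (u : Delta n) v v' :
  (forall k, (k < n)%N -> x k != x0) ->
  deforms x u v -> deforms x u v' -> v = v'.
Proof.
case: v v' => [q h] [q' h'] xn [e [/= se pe ->]] [e' [/= se' pe' ->]].
by have [-> ->] := spine_unique xn se se' (etrans pe (esym pe')).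
Qed.

Definition cell_deforms (c : {p & cell R J p}) (v : SX * (I -> B)) :=
  exists n (x : nat -> X) (phi : 'I_(projT1 c).+1 -> 'I_n.+1),
  [/\ Defs.monotone phi, phi ord0 = 0%N :> nat, phi ord_max = n :> nat,
    (projT2 c).1 = nerve_map phi ((fun i : 'I_n => eta (x i)) : kpow J n) &
    deforms x (simplex_map phi (projT2 c).2) v].

Lemma nerve_mapEnat p n (phi : 'I_p.+1 -> 'I_n.+1) (F : nat -> J) j :
  (j < p)%N -> extend (nerve_map phi ((fun i : 'I_n => F i) : kpow J n)) j =
  (\prod_(phi (inord j) <= k < phi (inord j.+1)) F k)%g.
Proof.
move=> jp; rewrite -[j in LHS]/(nat_of_ord (Ordinal jp)) extendE nerve_mapE.
congr (\big[_/_]_(nat_of_ord (phi _) <= _ < phi _) _); apply: val_inj.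
  by rewrite /= inordK// ltnS ltnW.
by rewrite /= inordK ?lift0// ltnS.
Qed.

(** Prefix products decide where letters are cut, so this equality compares the canonical maps of a
    cell and of a word presenting it. *)
Lemma nerve_map_prefix p n (phi : 'I_p.+1 -> 'I_n.+1) (F : nat -> J) m j :
  Defs.monotone phi -> phi ord0 = 0%N :> nat ->
  m = nerve_map phi ((fun i : 'I_n => F i) : kpow J n) -> (j <= p)%N ->
  (\prod_(0 <= k < j) extend m k)%g = (\prod_(0 <= k < phi (inord j)) F k)%g.
Proof.
move=> mphi phi0 -> jp.
have p0 : phi (inord 0) = 0%N :> nat.
  rewrite -[RHS]phi0; congr (nat_of_ord (phi _)).
  by apply: val_inj; rewrite /= inordK.
have gS k : (0 <= k < j)%N -> (phi (inord k) <= phi (inord k.+1))%N.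
  by move=> /andP[_ kj]; apply: mphi; rewrite !inordK; lia.
have [] := @prod_telescope J F (fun k => phi (inord k)) 0 j (leq0n _) gS.
rewrite p0 => <- _; apply: eq_big_nat => k /andP[_ kj].
by rewrite nerve_mapEnat//; lia.
Qed.

(** Deleting the basepoint letters of any presentation gives the canonical one: the canonical map of
    [m] is [phi] followed by the canonical map of the word, and [deforms_map] applies to the
    latter. *)
Lemma cell_deforms_canonical p (m : kpow J p) (u : Delta p) v s :
  jletters (\prod_(0 <= k < p) extend m k)%g = s ->
  cell_deforms (mkcell m u) v <->
  deforms (nth x0 s) (simplex_map (canonical_map (extend m) s) u) v.
Proof.
move=> Hs; split=> [|D]; last first.
  exists (size s), (nth x0 s), (canonical_map (extend m) s); split=> //.
  - exact: (canonical_map_monotone Hs).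
  - by rewrite (canonical_mapE Hs) letters_before0.
  - by rewrite (canonical_mapE Hs) (letters_before_max Hs).
  - by rewrite (canonical_map_nerve Hs) extendK.
move=> [n [x [phi [/= mphi phi0 phin mE D]]]].
pose F k := eta (x k).
have pre j := nerve_map_prefix (F := F) mphi phi0 mE (j := j).
have inordp : inord p = ord_max :> 'I_p.+1 by apply: val_inj; rewrite /= inordK.
have Hs' : jletters (\prod_(0 <= k < n) F k)%g = s.
  by rewrite -Hs pre// inordp phin.
have -> : canonical_map (extend m) s = canonical_map F s \o phi.
  apply/funext => j; apply: val_inj; rewrite /= (canonical_mapE Hs).
  rewrite (canonical_mapE Hs') /letters_before pre ?inord_val//.
  by rewrite -ltnS.
rewrite -simplex_map_comp; apply: deforms_map D => //.
- by move=> k ks; move: ks; rewrite -Hs; exact: nth_jletters_neq.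
- exact: (canonical_map_monotone Hs').
- move=> j jn; rewrite !(canonical_mapE Hs') !inordK; [|lia..].
  exact: (prod_letters_between Hs').
Qed.

Lemma cell_deforms_exists c : exists v, cell_deforms c v.
Proof.
case: c => p [m u].
set s := jletters (\prod_(0 <= k < p) extend m k)%g.
have [v D] := deforms_exists (nth x0 s)
  (simplex_map (canonical_map (extend m) s) u).
by exists v; apply/(cell_deforms_canonical _ _ (erefl s)).
Qed.

Lemma cell_deforms_unique c v v' :
  cell_deforms c v -> cell_deforms c v' -> v = v'.
Proof.
case: c => p [m u]; move=> /(cell_deforms_canonical _ _ (erefl _)) D.
move=> /(cell_deforms_canonical _ _ (erefl _)); apply: deforms_unique D.
by move=> k; exact: nth_jletters_neq.
Qed.

Lemma cell_deforms_word n x (u : Delta n) v :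
  deforms x u v -> cell_deforms (word_cell x u) v.
Proof.
move=> D; exists n, x, id; split=> //=.
  apply/funext => j; rewrite (nerve_mapE id (fun k => eta (x k))) /=.
  by rewrite /bump add1n big_nat1.
suff -> : simplex_map id u = u by [].
by apply: simplex_ext => i; rewrite simplex_mapE big_pred1_eq.
Qed.

(** The word of [nerve_map phi m] is the part of [s] between the positions [a] and [b]. The
    inclusion [sigma] of that interval of vertices is a composite of outer faces, to which
    [deforms_map] applies; any inner face is absorbed in [phi']. *)
Lemma cell_deforms_glue c c' : Defs.glue c c' ->
  exists v, cell_deforms c v /\ cell_deforms c' v.
Proof.
case=> q p phi m v mphi.
set s := jletters (\prod_(0 <= k < p) extend m k)%g.
have Hs : jletters (\prod_(0 <= k < p) extend m k)%g = s by [].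
pose Phi : 'I_p.+1 -> 'I_(size s).+1 := canonical_map (extend m) s.
have mPhi : Defs.monotone Phi by exact: (canonical_map_monotone Hs).
pose psi := Phi \o phi.
have mpsi : Defs.monotone psi by move=> i j ij; apply/mPhi/mphi.
pose a := nat_of_ord (psi ord0); pose b := nat_of_ord (psi ord_max).
have apsi j : (a <= psi j)%N by apply: mpsi.
have psib j : (psi j <= b)%N by apply: mpsi; rewrite -ltnS.
have bs : (b <= size s)%N by rewrite -ltnS ltn_ord.
pose x k := nth x0 s (a + k).
pose phi' (j : 'I_q.+1) : 'I_(b - a).+1 := inord (psi j - a).
have phi'E j : phi' j = (psi j - a)%N :> nat.
  by rewrite inordK// ltnS leq_sub2r.
have mphi' : Defs.monotone phi'.
  by move=> i j ij; rewrite !phi'E leq_sub2r//; exact: mpsi.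
pose sigma (j : 'I_(b - a).+1) : 'I_(size s).+1 := inord (a + j).
have ab : (a <= b)%N by exact: apsi.
have sigmaE j : sigma j = (a + j)%N :> nat.
  by rewrite inordK//; have := ltn_ord j; lia.
have sigma_phi' : sigma \o phi' = psi.
  apply/funext => j; apply: val_inj; rewrite /= sigmaE phi'E.
  by rewrite subnKC.
have [w' D] := deforms_exists x (simplex_map phi' v).
exists w'; split.
  exists (b - a)%N, x, phi'; split=> //.
    by exact: etrans (phi'E ord0) (subnn _).
  change (nerve_map phi m =
    nerve_map phi' ((fun i : 'I_(b - a) => eta (x i)) : kpow J (b - a))).
  apply/funext => j; rewrite (nerve_mapE phi' (fun k => eta (x k))) !phi'E.
  rewrite -[m in LHS]extendK nerve_mapE.
  set i1 := widen_ord _ _; set i2 := lift _ _.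
  have i12 : (phi i1 <= phi i2)%N by apply: mphi; rewrite /= /bump; lia.
  transitivity (\prod_(psi i1 <= k < psi i2) eta (nth x0 s k))%g; last first.
    have {1}-> : psi i1 = (psi i1 - a + a)%N :> nat by rewrite subnK.
    by rewrite big_addn; apply: eq_big_nat => k _; rewrite /x addnC.
  rewrite /psi /= !(canonical_mapE Hs).
  have [<- _] := prod_telescope (fun k => eta (nth x0 s k)) i12
    (fun k _ => letters_before_homo (extend m) (leqnSn k)).
  apply: eq_big_nat => k /andP[_ k2]; rewrite (prod_letters_between Hs)//.
  by apply: leq_trans k2 _; rewrite -ltnS.
apply/(cell_deforms_canonical _ _ Hs).
rewrite simplex_map_comp -/Phi -/psi -sigma_phi' -simplex_map_comp.
apply: deforms_map D => //.
- by move=> k; exact: nth_jletters_neq.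
- by move=> i j ij; rewrite !sigmaE leq_add2l.
- move=> j jn; rewrite !sigmaE !inordK; [|lia..].
  by rewrite addnS big_nat1.
Qed.

Lemma cell_deforms_rel c c' v : clos_refl_sym_trans _ (@Defs.glue R J) c c' ->
  cell_deforms c v -> cell_deforms c' v.
Proof.
move=> cc'; suff : cell_deforms c v <-> cell_deforms c' v by move=> [].
elim: cc' => {c c'} [c c' g|//|c c' _ [? ?]|c c' c'' _ [? ?] _ [? ?]].
- have [v' [D D']] := cell_deforms_glue g.
  by split=> [/cell_deforms_unique/(_ D) ->|/cell_deforms_unique/(_ D') ->].
- by split.
- by split; auto.
Qed.

Definition deformation (b : B) : SX * (I -> B) :=
  projT1 (cid (cell_deforms_exists (repr b))).

Lemma deformationE c v : cell_deforms c v -> deformation (classifying_pi c) = v.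
Proof.
rewrite /deformation; case: cid => v' D' D /=; apply: cell_deforms_unique D.
apply: cell_deforms_rel D'; apply/classifying_piP; exact: reprK.
Qed.

Lemma deformation_chart n x (u : Delta n) v :
  deforms x u v -> deformation (chart x u) = v.
Proof. by move=> /cell_deforms_word/deformationE. Qed.

Lemma chart_surjective (b : B) : exists n x (u : Delta n), b = chart x u.
Proof.
rewrite -[b]reprK; case: (repr b) => p [m u].
set s := jletters (\prod_(0 <= k < p) extend m k)%g.
have Hs : jletters (\prod_(0 <= k < p) extend m k)%g = s by [].
exists (size s), (nth x0 s), (simplex_map (canonical_map (extend m) s) u).
rewrite /chart /word_cell -classifying_glue; last exact: (canonical_map_monotone Hs).
by rewrite (canonical_map_nerve Hs) extendK.
Qed.

Lemma deformation0 b : (deformation b).2 (I0 R) = b.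
Proof.
have [n [x [u ->]]] := chart_surjective b; have [v D] := deforms_exists x u.
rewrite (deformation_chart D); case: D => e [_ _ ->].
by rewrite convex0.
Qed.
End Deformation.

(** * Continuity of the deformation *)

Lemma continuous_sub (R : realType) (T : topologicalType) (f g : T -> R) :
  continuous f -> continuous g -> continuous (fun x => f x - g x).
Proof. by move=> cf cg x; apply: cvgB; [exact: cf|exact: cg]. Qed.

(** * Testing continuity on compact Hausdorff spaces *)

Section TestMaps.
Context (R : realType) (X : topologicalType) (x0 : X).
Local Notation I := (unit_interval R).
Local Notation J := (james x0).
Local Notation eta := (james_unit x0).
Local Notation B := (classifying R J).
Local Notation Delta := (simplex R).
Local Notation SX := (susp R x0).

Definition word_map n (e : @word_space X n) : J :=
  word_reduce x0 (existT (@word_space X) n e).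

Lemma continuous_word_map n : continuous (@word_map n).
Proof.
apply/continuousP => A; rewrite james_openE => /sigT_openP; exact.
Qed.

Lemma word_map_surjective (m : J) : exists n e, @word_map n e = m.
Proof.
exists (projT1 (word_repr m)), (projT2 (word_repr m)).
by rewrite /word_map -sigT_eta; exact: (@word_reprK _ x0).
Qed.

Lemma word_map_quotient (A : set J) :
  (forall n, open (@word_map n @^-1` A)) -> open A.
Proof. by move=> oA; rewrite james_openE; apply/sigT_openP. Qed.

Lemma word_mapE n (e : @word_space X n) :
  word_map e = jword x0 [seq e i | i <- enum 'I_n].
Proof. by []. Qed.

Lemma eta_word_map x : eta x = word_map ((fun=> x) : @word_space X 1).
Proof.
rewrite word_mapE /james_unit; congr (jword x0 _).
by rewrite (enum_ordSl 0) enum_ord0.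
Qed.

Definition cell_pi p (c : cell R J p) : B := classifying_pi (existT _ p c).

Lemma continuous_classifying_pi : continuous (@classifying_pi R J).
Proof. exact: pi_continuous. Qed.

Lemma continuous_cell_pi p : continuous (@cell_pi p).
Proof.
exact: (continuous_comp_fun (@existT_continuous _ _ p) continuous_classifying_pi).
Qed.

Lemma cell_pi_surjective (b : B) : exists p c, @cell_pi p c = b.
Proof.
exists (projT1 (repr b)), (projT2 (repr b)); rewrite /cell_pi -sigT_eta.
exact: reprK.
Qed.

Lemma cell_pi_quotient (A : set B) :
  (forall p, open (@cell_pi p @^-1` A)) -> open A.
Proof.
by move=> oA; rewrite /open /= /quotient_open; apply/sigT_openP.
Qed.

Section Test.
Context (K : topologicalType).
Hypothesis cK : compact_hausdorff K.

Lemma continuous_eta (x : K -> X) :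
  continuous x -> continuous (fun k => eta (x k)).
Proof.
move=> cx; under [X in continuous X]funext do rewrite eta_word_map.
exact: (continuous_comp_fun (continuous_into_kpow (f := fun=> x) cK (fun=> cx))
  (@continuous_word_map 1)).
Qed.

Lemma continuous_chart n (x : K -> nat -> X) (u : K -> Delta n) :
  (forall i, (i < n)%N -> continuous (fun k => x k i)) -> continuous u ->
  continuous (fun k => chart x0 (x k) (u k)).
Proof.
move=> cx cu; apply: (@continuous_comp_fun _ _ _
  (fun k => ((fun i => eta (x k i)) : kpow J n, u k) : cell R J n) (@cell_pi n)).
  apply: continuous_into_kprod => //; apply: continuous_into_kpow => // i.
  by apply: continuous_eta; exact: cx.
exact: continuous_cell_pi.
Qed.

Lemma continuous_susp_pi (x : K -> X) (t : K -> I) :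
  continuous x -> continuous t -> continuous (fun k => susp_pi x0 (x k, t k)).
Proof.
move=> cx ct; apply: (continuous_comp_fun (continuous_into_kprod cK cx ct)).
exact: pi_continuous.
Qed.

Lemma continuous_convex n (t : K -> I) (u v : K -> Delta n) :
  continuous t -> continuous u -> continuous v ->
  continuous (fun k => convex (t k) (u k) (v k)).
Proof.
move=> ct cu cv; apply: continuous_into_set; apply: continuous_into_ptws => i.
have ct' := continuous_comp_fun ct (@continuous_set_val _ _).
have cu' := continuous_comp_fun (continuous_comp_fun cu (@continuous_set_val _ _))
  (@continuous_ptws_eval _ _ i).
have cv' := continuous_comp_fun (continuous_comp_fun cv (@continuous_set_val _ _))
  (@continuous_ptws_eval _ _ i).
rewrite (_ : (fun _ => _) = fun k => (1 - set_val (t k)) * set_val (u k) i +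
  set_val (t k) * set_val (v k) i)//.
move=> k; apply: cvgD; apply: cvgM; [|exact: cu'|exact: ct'|exact: cv'].
by apply: cvgB; [exact: cvg_cst|exact: ct'].
Qed.

Lemma continuous_pairing n (u : K -> Delta n) (f : K -> nat -> R) :
  continuous u -> (forall i, (i <= n)%N -> continuous (fun k => f k i)) ->
  continuous (fun k => pairing (u k) (f k)).
Proof.
move=> cu cf; apply: continuous_sum => i.
have cu' := continuous_comp_fun (continuous_comp_fun cu (@continuous_set_val _ _))
  (@continuous_ptws_eval _ _ i).
by move=> k; apply: cvgM; [exact: cu'|apply: (cf i); rewrite -ltnS].
Qed.

End Test.

Lemma continuous_edge : continuous (@edge R).
Proof.
apply: continuous_into_set; apply: continuous_into_ptws => i.
rewrite (_ : (fun _ => _) = fun t : I =>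
  if i == ord0 then 1 - set_val t else set_val t)//.
have cv : continuous (fun t : I => set_val t) := @continuous_set_val _ _.
case: (i == ord0); last exact: cv.
exact: (continuous_sub (@cst_continuous I R 1) cv).
Qed.

Lemma continuous_spine_edge n i : continuous (@spine_edge R n i).
Proof.
exact: (continuous_comp_fun continuous_edge (@simplex_map_continuous R _ _ _)).
Qed.

(** Two layers of quotients are undone: the cells of [B], by Whitehead's theorem for the product
    with [I], and then each entry in [J], lifted to a word in [X]. Concatenating these words
    presents the cell by a chart with continuous letters. *)
Lemma open_classifying_prod (W : set (B * I)) :
  (forall (K : topologicalType) n (x : K -> nat -> X) (u : K -> Delta n)
      (t : K -> I), compact_hausdorff K ->
    (forall i, (i < n)%N -> continuous (fun k => x k i)) -> continuous u ->
    continuous t -> open [set k | W (chart x0 (x k) (u k), t k)]) ->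
  open W.
Proof.
move=> oW; apply: (@open_prod_quotient nat (cell R J) B I cell_pi) => //.
- by move=> p; exact: kification_cg.
- exact: cell_pi_surjective.
- exact: cell_pi_quotient.
- exact: compact_hausdorff_unit_interval.
move=> p K c cK hK cc.
have c1 := continuous_comp_fun cc (@continuous_fst _ _).
have c2 := continuous_comp_fun cc (@continuous_snd _ _).
have cu := continuous_comp_fun c1 (@continuous_kprod_snd _ _).
have cm := continuous_comp_fun c1 (@continuous_kprod_fst _ _).
pose A (m : 'I_p -> J) (z : Delta p * I) : Prop :=
  W (classifying_pi (mkcell (m : kpow J p) z.1), z.2).
have := @open_lift_coordinates nat (@word_space X) J (Delta p * I)%type
  word_map p A.
move=> H; have {}H := H (fun n => @kification_cg _) word_map_surjective
  word_map_quotient continuous_word_map.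
have H0 : forall (K' : topologicalType) (n : 'I_p -> nat)
    (w : forall i, K' -> @word_space X (n i)) (z : K' -> Delta p * I),
    compact_hausdorff K' -> (forall i, continuous (w i)) -> continuous z ->
    open [set k | A (fun i => word_map (w i k)) (z k)].
  move=> K' n w z cK' cw cz; rewrite /A.
  (* [ss k] lists the words of the [p] entries. The lift fixes the length of each word, so the shape
     [sh] does not depend on [k] and the letters of the concatenation sit at fixed positions. *)
  pose ss k := [seq [seq w i k l | l <- enum 'I_(n i)] | i <- enum 'I_p].
  pose sh := [seq n i | i <- enum 'I_p].
  have shE k : shape (ss k) = sh.
    rewrite /shape -map_comp; apply: eq_map => i /=.
    by rewrite size_map size_enum_ord.
  pose x k := nth x0 (flatten (ss k)).
  have size_ss k : size (ss k) = p by rewrite size_map size_enum_ord.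
  (* Cuts the concatenation after the first [j] words. *)
  pose phi (j : 'I_p.+1) : 'I_(sumn sh).+1 := inord (sumn (take j sh)).
  have phiE j : phi j = sumn (take j sh) :> nat.
    by rewrite inordK// ltnS -[in leqRHS](cat_take_drop j sh) sumn_cat leq_addr.
  have mphi : Defs.monotone phi.
    move=> i j ij; rewrite !phiE -(subnKC ij) takeD sumn_cat leq_addr//.
  have piE k : classifying_pi (mkcell ((fun i => word_map (w i k)) : kpow J p)
      (z k).1) = chart x0 (x k) (simplex_map phi (z k).1).
    rewrite /chart /word_cell -classifying_glue//.
    congr (classifying_pi (mkcell _ _)); apply/funext => j.
    rewrite (nerve_mapE phi (fun i => eta (x k i))) !phiE /= /bump add1n.
    have jp : (j < size (ss k))%N by rewrite size_ss.
    have ssE : flatten (ss k) = flatten (take j (ss k)) ++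
        (nth [::] (ss k) j ++ flatten (drop j.+1 (ss k))).
      by rewrite -{1}(cat_take_drop j (ss k)) (drop_nth [::] jp) flatten_cat.
    have sA : sumn (take j sh) = size (flatten (take j (ss k))).
      by rewrite size_flatten -(shE k) /shape map_take.
    have sB : sumn (take j.+1 sh) =
        (size (flatten (take j (ss k))) + size (nth [::] (ss k) j))%N.
      have jsh : (j < size sh)%N by rewrite -(shE k) size_map.
      rewrite (take_nth 0%N jsh) sumn_rcons sA; congr addn.
      by rewrite -(shE k) (nth_map [::]).
    rewrite sA sB /x ssE prod_slice (nth_map j) ?size_enum_ord//.
    by rewrite nth_ord_enum.
  rewrite (_ : [set k | _] = [set k | W (chart x0 (x k)
      (simplex_map phi (z k).1), (z k).2)]); last first.
    by apply/funext => k /=; rewrite -piE.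
  apply: oW => //.
  + move=> i iN.
    (* Letter [i] of the concatenation is letter [o] of word [r]; indices out of range give the
       default letter [x0], a continuous constant. *)
    pose r := reshape_index sh i; pose o := reshape_offset sh i.
    have xE : (fun k => x k i) = fun k => nth x0 (nth [::] (ss k) r) o.
      by apply/funext => k; rewrite /x nth_flatten shE.
    have [pr|rp] := leqP p r.
      suff -> : (fun k => x k i) = fun=> x0 by exact: cst_continuous.
      rewrite xE; apply/funext => k.
      by rewrite (nth_default [::]) ?size_ss// nth_nil.
    have ssr k : nth [::] (ss k) r =
        [seq w (Ordinal rp) k l | l <- enum 'I_(n (Ordinal rp))].
      rewrite (nth_map (Ordinal rp)) ?size_enum_ord//.
      by rewrite (nth_ord_enum _ (Ordinal rp)).
    have [no|on] := leqP (n (Ordinal rp)) o.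
      suff -> : (fun k => x k i) = fun=> x0 by exact: cst_continuous.
      rewrite xE; apply/funext => k.
      by rewrite ssr nth_default// size_map size_enum_ord.
    have -> : (fun k => x k i) = fun k => w (Ordinal rp) k (Ordinal on).
      rewrite xE; apply/funext => k.
      rewrite ssr (nth_map (Ordinal on)) ?size_enum_ord//.
      by rewrite (nth_ord_enum _ (Ordinal on)).
    exact: (continuous_comp_fun (cw _) (@continuous_kpow_eval _ _ _)).
  + exact: (continuous_comp_fun (continuous_comp_fun cz (@continuous_fst _ _))
      (@simplex_map_continuous R _ _ _)).
  + exact: (continuous_comp_fun cz (@continuous_snd _ _)).
have -> : c @^-1` [set q | W (cell_pi q.1, q.2)] =
    [set k | A (fun i => (c k).1.1 i) ((c k).1.2, (c k).2)].
  by apply/funext => k; rewrite /A /cell_pi /mkcell /=; case: (c k) => [[m u] t].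
apply: (H H0 K (fun i k => (c k).1.1 i) (fun k => ((c k).1.2, (c k).2))) => //.
- by move=> i; exact: (continuous_comp_fun cm (@continuous_kpow_eval _ _ i)).
- exact: continuous_pair.
Qed.

Lemma continuous_from_classifying_prod (T : topologicalType) (F : B * I -> T) :
  (forall (K : topologicalType) n (x : K -> nat -> X) (u : K -> Delta n)
      (t : K -> I), compact_hausdorff K ->
    (forall i, (i < n)%N -> continuous (fun k => x k i)) -> continuous u ->
    continuous t -> continuous (fun k => F (chart x0 (x k) (u k), t k))) ->
  continuous F.
Proof.
move=> cF; apply/continuousP => A oA; apply: open_classifying_prod.
move=> K n x u t cK cx cu ct.
by have /continuousP/(_ A oA) := cF K n x u t cK cx cu ct.
Qed.

End TestMaps.

Section DeformationContinuity.
Context (R : realType) (X : topologicalType) (x0 : X) (w : X -> R).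
Hypothesis w_ge0 : forall x, 0 <= w x.
Hypothesis w_eq0 : forall x, w x = 0 <-> x = x0.
Hypothesis w_cont : forall (K : topologicalType) (u : K -> X),
  compact_hausdorff K -> continuous u -> continuous (w \o u).
Local Notation I := (unit_interval R).
Local Notation J := (james x0).
Local Notation eta := (james_unit x0).
Local Notation B := (classifying R J).
Local Notation Delta := (simplex R).
Local Notation SX := (susp R x0).
Local Notation deformation := (deformation w_ge0 w_eq0).

Lemma continuous_total_weight (K : topologicalType) n (x : K -> nat -> X) j :
  compact_hausdorff K ->
  (forall i, (i < n)%N -> continuous (fun k => x k i)) -> (j <= n)%N ->
  continuous (fun k => total_weight w (x k) j).
Proof.
move=> cK cx jn; rewrite /total_weight.
have -> : (fun k => \sum_(0 <= i < j) w (x k i)) =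
    (fun k => \sum_(i < j) w (x k i)) by apply/funext => k; rewrite big_mkord.
apply: continuous_sum => i; apply: (w_cont cK (cx i _)).
exact: leq_trans (ltn_ord i) jn.
Qed.

Lemma closed_eq_fun (K : topologicalType) (f g : K -> R) :
  continuous f -> continuous g -> closed [set k | f k = g k].
Proof.
move=> cf cg; have -> : [set k | f k = g k] = (fun k => f k - g k) @^-1` [set 0].
  apply/seteqP; split=> k /= => [->|/eqP]; first by rewrite subrr.
  by rewrite subr_eq0 => /eqP.
have /continuous_closedP := continuous_sub cf cg; apply.
exact: (accessible_closed_set1 (hausdorff_accessible (@Rhausdorff R))).
Qed.

(* The point of the spine chosen by [deforms] does not depend continuously on
   the word near letters equal to the basepoint, whence the parameter. *)
Lemma continuous_on_spine (K T : topologicalType) n (x : K -> nat -> X)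
    (u : K -> Delta n) (f : K -> T) (g : Delta n * SX -> K -> T) :
  compact_hausdorff K -> (forall i, (i < n)%N -> continuous (fun k => x k i)) ->
  continuous u ->
  (forall i, (i < n)%N ->
    continuous (fun p : K * I =>
      g (spine_edge n i p.2, susp_pi x0 (x p.1 i, p.2)) p.1)) ->
  (forall j, continuous (g (vertex R j, susp_base R x0))) ->
  (forall k e q, spine (x k) e q -> pairing e (total_weight w (x k)) =
    pairing (u k) (total_weight w (x k)) -> f k = g (e, q) k) ->
  continuous f.
Proof.
move=> cK cx cu cge cgv fE.
pose P k := pairing (u k) (total_weight w (x k)).
have cT j : (j <= n)%N -> continuous (fun k => total_weight w (x k) j).
  exact: (continuous_total_weight cK cx).
have cP : continuous P by exact: continuous_pairing.
(* The parameter is the coordinate on a spine edge, idle in the vertex case. [Gam j] is the closed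
   condition that the spine point it designates has the same weight value as [u k]. *)
pose Gam (j : 'I_n + 'I_n.+1) : set (K * I) := match j with
  | inl i => [set p | total_weight w (x p.1) i + set_val p.2 *
      (total_weight w (x p.1) i.+1 - total_weight w (x p.1) i) = P p.1]
  | inr j => [set p | total_weight w (x p.1) j = P p.1] end.
pose G (j : 'I_n + 'I_n.+1) : K * I -> T := match j with
  | inl i => fun p => g (spine_edge n i p.2, susp_pi x0 (x p.1 i, p.2)) p.1
  | inr j => fun p => g (vertex R j, susp_base R x0) p.1 end.
have c1 := @continuous_fst K I.
have c2 := continuous_comp_fun (@continuous_snd K I) (@continuous_set_val R _).
apply: (@continuous_multivalued _ K I T Gam G) => //.
- exact: compact_hausdorff_unit_interval.
- move=> [i|j]; apply: closed_eq_fun; try exact: (continuous_comp_fun c1 cP).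
    have ci := continuous_comp_fun c1 (cT i (ltnW (ltn_ord i))).
    have ci1 := continuous_comp_fun c1 (cT i.+1 (ltn_ord i)).
    move=> p; apply: cvgD; first exact: ci.
    by apply: cvgM; [exact: c2|exact: (continuous_sub ci1 ci)].
  by apply: (continuous_comp_fun c1 (cT j _)); rewrite -ltnS.
- by move=> [i|j]; [exact: cge|exact: (continuous_comp_fun c1 (cgv j))].
- move=> k; have [v [e [se pe _]]] := deforms_exists x0 w_ge0 (x k) (u k).
  case: se pe => [[i [t [iin -> _]]]|[j [-> _]]].
    by rewrite pairing_spine_edge// => pe; exists (inl (Ordinal iin)), t.
  by rewrite pairing_vertex => pe; exists (inr j), (I0 R).
- move=> [i|j] k c /= Gc; apply: fE.
  + by left; exists i, c.
  + by rewrite pairing_spine_edge.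
  + by right; exists j.
  + by rewrite pairing_vertex.
Qed.

Lemma continuous_retraction : continuous (fun b : B => (deformation b).1).
Proof.
(* An idle interval coordinate is added because the continuity test is stated on [B * I]. *)
suff : continuous (fun p : B * I => (deformation p.1).1).
  move=> c; exact: (continuous_comp_fun
    (continuous_pair (@continuous_idfun B) (@cst_continuous B I (I0 R))) c).
apply: continuous_from_classifying_prod => K n x u t cK cx cu ct /=.
apply: (@continuous_on_spine K SX n x u _ (fun v _ => v.2)) => //.
- move=> i iin; apply: continuous_susp_pi.
  + exact: compact_hausdorff_prod cK (compact_hausdorff_unit_interval R).
  + exact: (continuous_comp_fun (@continuous_fst _ _) (cx i iin)).
  + exact: continuous_snd.
- by move=> j; exact: cst_continuous.
move=> k e q se pe; rewrite (@deformation_chart _ _ _ _ _ _ _ _ _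
  (q, fun t => chart x0 (x k) (convex t (u k) e)))//.
by exists e.
Qed.

Lemma continuous_homotopy : continuous (fun p : B * I => (deformation p.1).2 p.2).
Proof.
apply: continuous_from_classifying_prod => K n x u t cK cx cu ct /=.
apply: (@continuous_on_spine K B n x u _
  (fun v k => chart x0 (x k) (convex (t k) (u k) v.1))) => //.
- move=> i iin; have c1 := @continuous_fst K I.
  have cKI := compact_hausdorff_prod cK (compact_hausdorff_unit_interval R).
  apply: (continuous_chart cKI (x := fun p : K * I => x p.1)).
    by move=> l ln; exact: (continuous_comp_fun c1 (cx l ln)).
  apply: continuous_convex; first exact: (continuous_comp_fun c1 ct).
    exact: (continuous_comp_fun c1 cu).
  exact: (continuous_comp_fun (@continuous_snd _ _) (@continuous_spine_edge R n i)).
- move=> j; apply: continuous_chart => //; apply: continuous_convex => //.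
  exact: cst_continuous.
move=> k e q se pe; rewrite (@deformation_chart _ _ _ _ _ _ _ _ _
  (q, fun t => chart x0 (x k) (convex t (u k) e)))//.
by exists e.
Qed.

Definition susp_inclusion : SX -> B :=
  @iotaB R J \o susp_map (R := R) (x0 := x0) (1%g : J) eta.

Lemma eta_base : eta x0 = 1%g.
Proof. by apply: (can_inj (@jlettersK _ x0)); rewrite jletters_eta eqxx. Qed.

Lemma susp_inclusionE x t :
  susp_inclusion (susp_pi x0 (x, t)) = chart x0 (n := 1) (fun=> x) (edge t).
Proof. by rewrite /susp_inclusion /= susp_mapE ?eta_base// iotaBE. Qed.

Lemma continuous_susp_inclusion : continuous susp_inclusion.
Proof.
apply/(@quotient_continuous _ (susp R x0)).
apply: continuous_from_cg; first exact: kification_cg.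
move=> K u cK cu.
have -> : (susp_inclusion \o \pi_(susp R x0)) \o u =
    fun k => chart x0 (n := 1) (fun=> (u k).1) (edge (u k).2).
  apply/funext => k /=; rewrite -susp_inclusionE /susp_pi.
  by rewrite -surjective_pairing.
apply: (continuous_chart cK (x := fun k _ => (u k).1)).
  by move=> _ _; exact: (continuous_comp_fun cu (@continuous_kprod_fst _ _)).
apply: (continuous_comp_fun _ (@continuous_edge R)).
exact: (continuous_comp_fun cu (@continuous_kprod_snd _ _)).
Qed.

Lemma spine_edge_edge t : spine_edge 1 0 t = edge t :> Delta 1.
Proof.
apply: simplex_ext => i; rewrite /spine_edge simplex_mapE.
rewrite (big_pred1 i)// => j; rewrite /consecutive add0n inord_val.
by [].
Qed.

(** The point already lies on the spine of a one-letter word, so its segment is constant. *)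
Lemma deformation_susp_inclusion q :
  deformation (susp_inclusion q) = (q, fun=> susp_inclusion q).
Proof.
rewrite -[q]reprK; case: (repr q) => x t; rewrite -/(susp_pi x0 (x, t)).
rewrite susp_inclusionE; apply: deformation_chart; exists (edge t); split=> //=.
  by left; exists 0%N, t; rewrite spine_edge_edge.
by apply/funext => s; rewrite convex_id.
Qed.

(** The nerve of a monoid has a single vertex, to which the edge labelled by the basepoint is also
    collapsed. *)
Lemma chart_vertex n (x : nat -> X) (j : 'I_n.+1) :
  chart x0 x (vertex R j) = susp_inclusion (susp_base R x0).
Proof.
have v : simplex R 0 := vertex R ord0.
rewrite susp_inclusionE -(@simplex_map_cst R 0 n (fun=> j) j v)//.
rewrite -(@chart_map _ _ _ 0 n _ (fun=> x0))//.
symmetry; rewrite -[LHS]/(classifying_pi (edge_cell (eta x0) (I0 R))).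
rewrite (@edge_collapsed R J _ _ v); last by rewrite /collapsed /= eta_base eqxx.
congr (classifying_pi (mkcell _ v)); apply/funext => -[].
by [].
Qed.

(** The [i]-th spine edge of a word is its face with the single letter [x i]. *)
Lemma deformation1 b : (deformation b).2 (I1 R) = susp_inclusion (deformation b).1.
Proof.
have [n [x [u ->]]] := chart_surjective b.
have [v D] := deforms_exists x0 w_ge0 x u.
rewrite (deformation_chart _ _ D); case: D => e [se _ ->]; rewrite convex1.
case: se => [[i [t [iin -> ->]]]|[j [-> ->]]]; last exact: chart_vertex.
rewrite susp_inclusionE /spine_edge -(@chart_map _ _ _ 1 n _ (fun=> x i))//.
  move=> k l kl; rewrite /consecutive !inordK ?leq_add2l//.
    by have := ltn_ord l; lia.
  by have := ltn_ord k; lia.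
move=> j; rewrite ltnS leqn0 => /eqP ->.
rewrite /consecutive !inordK ?addn0 ?addn1//; try lia.
by rewrite big_nat1.
Qed.

Section Equivariance.
Context (f : X -> X).
Hypothesis f0 : f x0 = x0.
Hypothesis fw : forall x, w (f x) = w x.

Let fB : B -> B := classifying_map (james_map (x0 := x0) f).

Lemma chart_equivariant n x (u : Delta n) :
  fB (chart x0 x u) = chart x0 (f \o x) u.
Proof.
have [f1 fM] := james_map_monoid f0.
rewrite /fB /chart /word_cell classifying_mapE//.
congr (classifying_pi (mkcell _ u)); apply/funext => i /=.
by rewrite /james_unit james_mapE.
Qed.

Lemma susp_inclusion_equivariant q :
  susp_inclusion (susp_map x0 f q) = fB (susp_inclusion q).
Proof.
rewrite -[q]reprK; case: (repr q) => x t; rewrite -/(susp_pi x0 (x, t)).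
by rewrite susp_mapE// !susp_inclusionE chart_equivariant.
Qed.

(** [f] moves the letters but keeps their weights, so the same spine point [e] serves both words. *)
Lemma deformation_equivariant b : deformation (fB b) =
  (susp_map x0 f (deformation b).1, fun t => fB ((deformation b).2 t)).
Proof.
have [n [x [u ->]]] := chart_surjective b.
have [v D] := deforms_exists x0 w_ge0 x u.
rewrite chart_equivariant (deformation_chart _ _ D); apply: deformation_chart.
have TE : total_weight w (f \o x) = total_weight w x.
  by apply/funext => j; apply: eq_bigr => k _; rewrite /= fw.
case: D => e [se pe hE]; exists e; split; rewrite ?TE//=.
  case: se => [[i [t [iin -> ->]]]|[j [-> ->]]].
    by left; exists i, t; split=> //; rewrite susp_mapE.
  by right; exists j; split=> //; rewrite susp_mapE// f0.
by rewrite hE; apply/funext => t; rewrite chart_equivariant.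
Qed.

End Equivariance.

End DeformationContinuity.

(** * Equivariant deformation retracts *)

Section DeformationRetract.
Context (R : realType) (G : topGroupType) (A B : topologicalType).
Context (a : G -> A -> A) (b : G -> B -> B) (i : A -> B) (r : B -> A).
Local Notation I := (unit_interval R).
Context (h : B * I -> B).
Hypothesis ie : equivariant a b i.
Hypothesis re : equivariant b a r.
Hypothesis he : forall g y t, h (b g y, t) = b g (h (y, t)).
Hypothesis ci : continuous i.
Hypothesis cr : continuous r.
Hypothesis ch : continuous h.
Hypothesis ri : forall x, r (i x) = x.
Hypothesis h0 : forall y, h (y, I0 R) = y.
Hypothesis h1 : forall y, h (y, I1 R) = i (r y).
Hypothesis hi : forall x t, h (i x, t) = i x.

Lemma continuous_fixed_map (S T : topologicalType) (c : G -> S -> S)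
    (d : G -> T -> T) (f : S -> T) (fe : equivariant c d f) (H : set G) :
  continuous f -> continuous (fixed_map fe (H := H)).
Proof.
move=> cf; apply: continuous_into_set.
exact: (continuous_comp_fun (@continuous_set_val _ _) cf).
Qed.

(** [weak_equivalence] asks for homotopies that start in the image of [f], whereas [h] runs from the
    identity to [i \o r]. *)
Definition reverseI (t : I) : I := clampI (1 - set_val t).

Lemma continuous_reverseI : continuous reverseI.
Proof.
exact: (continuous_comp_fun (continuous_sub (@cst_continuous I R 1)
  (@continuous_set_val _ _)) (@continuous_clampI R)).
Qed.

Lemma reverseI0 : reverseI (I0 R) = I1 R.
Proof. by rewrite /reverseI subr0; exact: (clampI_id (I1 R)). Qed.

Lemma reverseI1 : reverseI (I1 R) = I0 R.
Proof. by rewrite /reverseI subrr; exact: (clampI_id (I0 R)). Qed.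

(** The injectivity clauses follow by composing with the retraction, the surjectivity clauses from
    the homotopy, which is relative to the boundary of the cube because it is stationary on the
    image of [i]. *)
Lemma retract_weak_equivalence (H : set G) :
  weak_equivalence R (fixed_map ie (H := H)).
Proof.
pose iH := fixed_map ie (H := H); pose rH := fixed_map re (H := H).
have hHP (p : fixed_points b H * I) :
    h (set_val p.1, reverseI p.2) \in fixed_points b H.
  by apply: mem_set => g Hg; rewrite -he (set_valP p.1).
pose hH (p : fixed_points b H * I) : fixed_points b H :=
  exist (fun y => y \in fixed_points b H) _ (hHP p).
have ciH : continuous iH by exact: continuous_fixed_map.
have crH : continuous rH by exact: continuous_fixed_map.
have chH : continuous hH.
  apply: continuous_into_set; apply: (continuous_comp_fun _ ch).
  apply: continuous_pair.
    exact: (continuous_comp_fun (@continuous_fst _ _)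
      (@continuous_set_val _ _)).
  exact: (continuous_comp_fun (@continuous_snd _ _) continuous_reverseI).
have riH x : rH (iH x) = x by apply: set_val_inj; exact: ri.
have hH0 y : hH (y, I0 R) = iH (rH y).
  by apply: set_val_inj; rewrite set_valE /= reverseI0 h1.
have hH1 y : hH (y, I1 R) = y.
  by apply: set_val_inj; rewrite set_valE /= reverseI1 h0.
have hHi x t : hH (iH x, t) = iH x by apply: set_val_inj; exact: hi.
split=> //.
- move=> x x' [c cc [c0 c1]]; exists (rH \o c).
    exact: (continuous_comp_fun cc crH).
  by rewrite /= c0 c1 !riH.
- move=> y; exists (rH y), (fun t => hH (y, t)).
    exact: (continuous_comp_fun (continuous_pair (@cst_continuous _ _ y)
      (@continuous_idfun I)) chH).
  by rewrite hH0 hH1.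
- move=> n x u v _ [cu ux] [cv vx] [k ck [k0 k1 kb]].
  exists (rH \o k); first exact: (continuous_comp_fun ck crH).
  split=> [s|s|s t sb] /=.
  + by rewrite k0 /= riH.
  + by rewrite k1 /= riH.
  + by rewrite kb// riH.
- move=> n x v _ [cv vx]; exists (rH \o v).
    split; first exact: (continuous_comp_fun cv crH).
    by move=> s sb /=; rewrite vx// riH.
  exists (fun p => hH (v p.1, p.2)).
    apply: (continuous_comp_fun _ chH); apply: continuous_pair.
      exact: (continuous_comp_fun (@continuous_fst _ _) cv).
    exact: continuous_snd.
  split=> [s|s|s t sb] /=.
  + by rewrite hH0.
  + by rewrite hH1.
  + by rewrite vx// hHi.
Qed.

End DeformationRetract.

Theorem theorem5p49 (R : realType) (G : topGroupType) (X : topologicalType)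
    (a : G -> X -> X) (x0 : X)
    (hX : cgwh X) (ha : is_gspace a) (hx0 : forall g : G, a g x0 = x0)
    (hnd : nondegenerately_based R a x0) :
  g_weak_equivalence R
    (susp_act (R := R) a (x0 := x0))
    (classifying_act (R := R) (james_act a (x0 := x0)))
    (@iotaB R (james x0) \o
       susp_map (R := R) (x0 := x0) (1%g : james x0) (james_unit x0)).
Proof.
have [w [w_ge0 w_eq0 w_inv w_cont]] := nondegenerate_weight hx0 hX ha hnd.
have ci := @continuous_susp_inclusion R X x0.
pose d := deformation w_ge0 w_eq0 : classifying R (james x0) -> _.
have dE g y := deformation_equivariant w_ge0 w_eq0 (hx0 g) (w_inv g) y.
have ie : equivariant (susp_act (R := R) a (x0 := x0))
    (classifying_act (R := R) (james_act a (x0 := x0))) (@susp_inclusion R X x0).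
  by move=> g q; exact: (susp_inclusion_equivariant (hx0 g)).
split; first exact: ci.
exists ie => H _ _.
apply: (@retract_weak_equivalence R G _ _ _ _ _ (fun y => (d y).1)
  (fun p => (d p.1).2 p.2)) => //.
- by move=> g y; rewrite /d [in LHS]dE.
- by move=> g y t; rewrite /d /= [in LHS]dE.
- exact: continuous_retraction.
- exact: continuous_homotopy.
- by move=> x; rewrite /d deformation_susp_inclusion.
- by move=> y; rewrite /d /= deformation0.
- by move=> y; rewrite /d /= deformation1.
- by move=> x t; rewrite /d /= deformation_susp_inclusion.
Qed.
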